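(* Let $F$ be a free group and let $\phi : F \to F$ be a 1-generator endomorphism, i.e. an endomorphism for which there is a free basis $X$ of $F$ such that $\phi$ fixes all but possibly one of the elements of $X$. Then $\phi$ is inert; that is, the image $H = F\phi$ satisfies $\mathrm{rk}(H \cap G) \leq \mathrm{rk}(G)$ for every subgroup $G$ of $F$.
   Context: $\mathrm{rk}$ denotes the rank of a free group (the cardinality of a free basis); the trivial group has rank $0$. Maps are written on the right, so $F\phi$ is the image of $\phi$. A subgroup $H$ of a free group $F$ is called inert in $F$ if $\mathrm{rk}(H \cap G) \leq \mathrm{rk}(G)$ for every subgroup $G$ of $F$. An endomorphism $\phi$ of a free group $F$ is called inert if its image is inert in $F$. The element of the basis that is not required to be fixed by a 1-generator endomorphism may be sent to an arbitrary element of $F$. The symbol for ''subgroup'' does not require the subgroup to be proper. *)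

(* Defs.v *)
From mathcomp Require Import all_boot.
From mathcomp Require Import boolp classical_sets functions cardinality.

Set Implicit Arguments.
Unset Strict Implicit.
Unset Printing Implicit Defensive.

Local Open Scope classical_set_scope.
Local Open Scope card_scope.
Local Open Scope group_scope.

(* Groups may be infinite, so subgroups are sets [set F] rather than the
   [{group gT}] of finite group theory. *)
Definition is_subgroup (F : groupType) (K : set F) : Prop := group_closed (mem K).

(* Words in X and the inverses of its elements: the letter (x, true) stands
   for x and the letter (x, false) for x^-1. *)
Definition word_on (F : groupType) (X : set F) (w : seq (F * bool)) : Prop :=
  forall a, a \in w -> X a.1.

Definition inverse_letters (F : groupType) (a b : F * bool) : bool :=
  (a.1 == b.1) && (a.2 != b.2).

Definition reduced (F : groupType) (w : seq (F * bool)) : bool :=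
  sorted (fun a b => ~~ inverse_letters a b) w.

Definition word_val (F : groupType) (w : seq (F * bool)) : F :=
  \prod_(a <- w) (if a.2 then a.1 else a.1^-1).

(* X is a free basis of the subgroup K: every element of K is the value of
   exactly one reduced word in X. *)
Definition free_basis (F : groupType) (K X : set F) : Prop :=
  X `<=` K /\
  forall g, K g ->
    exists! w : seq (F * bool), [/\ word_on X w, reduced w & word_val w = g].

Definition is_free (F : groupType) : Prop :=
  exists X : set F, free_basis [set: F] X.

(* rk K <= rk G as cardinals. Inside a free group every subgroup has a free
   basis (Nielsen-Schreier), and all free bases of a given subgroup are
   equipotent, so any pair of bases may be compared. *)
Definition rank_le (F : groupType) (K G : set F) : Prop :=
  forall A B : set F, free_basis K A -> free_basis G B -> A #<= B.

Definition inert_subgroup (F : groupType) (H : set F) : Prop :=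
  is_subgroup H /\
  forall G : set F, is_subgroup G -> rank_le (H `&` G) G.

Definition inert_endomorphism (F : groupType)
    (phi : {multiplicative F -> F}) : Prop :=
  inert_subgroup (range phi).

(* The exceptional element x is not required to lie in X, which may be empty;
   if it does not, phi fixes all of X. *)
Definition one_generator (F : groupType)
    (phi : {multiplicative F -> F}) : Prop :=
  exists X : set F, free_basis [set: F] X /\
    exists x : F, forall y : F, X y -> y <> x -> phi y = y.

(* Main.v *)
(* Let X be the basis and X' = X minus x, so that H is generated by X' and
   w = phi(x).  The group F acts on the cosets of G.  A finite subset A' of a basis
   of the intersection K of H and G consists of loops at the base point in the graph
   with edges labelled by X' and w; replacing each w-edge by the path that spells w
   gives a finite part of the Schreier graph of G, whose first Betti number is at
   most rk G.  Comparing Euler characteristics, |A'| <= rk G reduces to finding as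
   many edges outside the component of the base point in the H-graph as there are
   vertices, after deleting one "marked" x-edge from each w-path.  Marking in every
   w-path the x-edge that is largest for a left order of F does it: otherwise some
   component of what remains is a tree missing that component; it lifts to the
   Cayley graph, and the w-path through the smallest marked edge at its boundary
   has to leave the tree through a smaller one.  When rk G is infinite, rk K is at
   most the cardinality of G, which is rk G. *)

Require Import Defs.
From mathcomp Require Import all_boot.
From mathcomp Require Import all_algebra finmap zify wochoice.
From mathcomp Require Import boolp classical_sets functions cardinality.

Set Implicit Arguments.
Unset Strict Implicit.
Unset Printing Implicit Defensive.

Local Open Scope classical_set_scope.
Local Open Scope card_scope.
Local Open Scope group_scope.

(** * Words and free bases *)

Section Words.
Variable F : groupType.
Implicit Types (a b : F * bool) (u v w : seq (F * bool)) (X K : set F).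

Definition letter_inv a : F * bool := (a.1, ~~ a.2).
Definition letter_val a : F := if a.2 then a.1 else a.1^-1.
Definition word_inv w : seq (F * bool) := rev (map letter_inv w).

Lemma letter_invK : involutive letter_inv.
Proof. by case=> x b; rewrite /letter_inv /= negbK. Qed.

Lemma inverse_lettersE a b : inverse_letters a b = (b == letter_inv a).
Proof.
case: a b => x b [y c]; rewrite /inverse_letters /letter_inv xpair_eqE /= eq_sym.
by congr (_ && _); case: b c => [] [].
Qed.

Lemma letter_val_inv a : letter_val (letter_inv a) = (letter_val a)^-1.
Proof. by case: a => x []; rewrite /letter_val //= invgK. Qed.

Lemma word_val_nil : word_val [::] = 1 :> F.
Proof. by rewrite /word_val big_nil. Qed.

Lemma word_val_cons a w : word_val (a :: w) = letter_val a * word_val w.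
Proof. by rewrite /word_val big_cons. Qed.

Lemma word_val_cat u v : word_val (u ++ v) = word_val u * word_val v.
Proof. by rewrite /word_val big_cat. Qed.

Lemma word_val_rcons u a : word_val (rcons u a) = word_val u * letter_val a.
Proof. by rewrite -cats1 word_val_cat word_val_cons word_val_nil mulg1. Qed.

Lemma word_inv_cons a w : word_inv (a :: w) = rcons (word_inv w) (letter_inv a).
Proof. by rewrite /word_inv /= rev_cons. Qed.

Lemma word_inv_cat u v : word_inv (u ++ v) = word_inv v ++ word_inv u.
Proof. by rewrite /word_inv map_cat rev_cat. Qed.

Lemma word_val_inv w : word_val (word_inv w) = (word_val w)^-1.
Proof.
elim: w => [|a w IH]; first by rewrite word_val_nil invg1.
by rewrite word_inv_cons word_val_rcons IH letter_val_inv word_val_cons invgM.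
Qed.

Lemma word_on_cons X a w : word_on X (a :: w) <-> X a.1 /\ word_on X w.
Proof.
split=> [h|[Xa hw] b]; last by rewrite inE => /orP[/eqP->|/hw].
split; first by apply: h; rewrite mem_head.
by move=> b bw; apply: h; rewrite inE bw orbT.
Qed.

Lemma word_on_cat X u v : word_on X (u ++ v) <-> word_on X u /\ word_on X v.
Proof.
split=> [h|[hu hv] b]; last by rewrite mem_cat => /orP[/hu|/hv].
by split=> b bu; apply: h; rewrite mem_cat bu ?orbT.
Qed.

Lemma word_on_inv X w : word_on X w -> word_on X (word_inv w).
Proof.
by move=> h b; rewrite mem_rev => /mapP[a /h Xa ->].
Qed.

Arguments reduced : simpl never.

Lemma reduced_cons a w :
  reduced (a :: w) = (if w is b :: _ then b != letter_inv a else true) && reduced w.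
Proof. by case: w => [|b w] //; rewrite /reduced /= inverse_lettersE. Qed.

Lemma reduced_cat u v :
  reduced (u ++ v) =
  [&& reduced u, reduced v &
      (if (rev u, v) is (a :: _, b :: _) then b != letter_inv a else true)].
Proof.
elim: u => [|c u IH]; first by rewrite andbT.
rewrite cat_cons reduced_cons IH [in RHS]reduced_cons rev_cons.
case: u IH => [|d u] _; first by case: v => [|b v]; rewrite ?andbT //= andbC.
rewrite rev_cons; case: (rev u) => [|e u'] /=; rewrite -!andbA //.
Qed.

Lemma reduced_catl u v : reduced (u ++ v) -> reduced u.
Proof. by rewrite reduced_cat => /and3P[]. Qed.

Lemma reduced_catr u v : reduced (u ++ v) -> reduced v.
Proof. by rewrite reduced_cat => /and3P[]. Qed.

Lemma reduced_inv w : reduced w -> reduced (word_inv w).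
Proof.
elim: w => // a w IH; rewrite reduced_cons word_inv_cons -cats1 reduced_cat.
move=> /andP[haw /IH->] /=; rewrite /word_inv revK.
by case: w haw {IH} => //= b w; rewrite letter_invK eq_sym.
Qed.

Definition push_letter a w :=
  if w is b :: w' then if b == letter_inv a then w' else a :: w else [:: a].

Definition normal_form w := foldr push_letter [::] w.

Lemma reduced_normal_form w : reduced (normal_form w).
Proof.
elim: w => //= a w; case: (normal_form w) => // b u /=.
case: ifP => [_|/negbT ba]; first by rewrite reduced_cons => /andP[].
by rewrite !reduced_cons ba.
Qed.

Lemma word_on_normal_form X w : word_on X w -> word_on X (normal_form w).
Proof.
elim: w => //= a w IH /word_on_cons[Xa /IH].
case: (normal_form w) => [|b u] hb; first exact/word_on_cons.
by rewrite /=; case: ifP => _; [case/word_on_cons: hb | apply/word_on_cons].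
Qed.

Lemma word_val_normal_form w : word_val (normal_form w) = word_val w.
Proof.
elim: w => //= a w IH; rewrite word_val_cons -IH.
case: (normal_form w) => [|b u] /=; first by rewrite word_val_cons.
case: ifP => [/eqP->|_]; last by rewrite word_val_cons.
by rewrite word_val_cons letter_val_inv mulVKg.
Qed.

(** Each cancellation made by [push_letter] removes two letters whose steps undo each other on every
    state. This lets a function on words descend to the free group. *)
Lemma foldl_normal_form X T (step : T -> F * bool -> T) t w :
    (forall t a, X a.1 -> step (step t a) (letter_inv a) = t) ->
  word_on X w -> foldl step t (normal_form w) = foldl step t w.
Proof.
move=> stepK; elim: w t => //= a w IH t /word_on_cons[Xa /IH {}IH].
rewrite -IH; case: (normal_form w) => [|b u] //=.
by case: ifP => [/eqP->|_] //=; rewrite stepK.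
Qed.

Section FreeBasis.
Variables K X : set F.
Hypothesis bX : free_basis K X.

Definition reduced_word g : seq (F * bool) :=
  xget [::] [set w | [/\ word_on X w, reduced w & word_val w = g]].

Lemma reduced_wordP g : K g ->
  [/\ word_on X (reduced_word g), reduced (reduced_word g)
    & word_val (reduced_word g) = g].
Proof.
move=> Kg; have [w [hw _]] := bX.2 _ Kg.
exact: (@xgetPex _ [::] [set w | [/\ word_on X w, reduced w & word_val w = g]]
  (ex_intro _ w hw)).
Qed.

Lemma reduced_word_val w : K (word_val w) -> word_on X w ->
  reduced_word (word_val w) = normal_form w.
Proof.
move=> Kw hw; have [w' [_ uniq_w']] := bX.2 _ Kw.
rewrite -(uniq_w' _ (reduced_wordP Kw)); apply: uniq_w'; split.
- exact: word_on_normal_form.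
- exact: reduced_normal_form.
- exact: word_val_normal_form.
Qed.

Lemma normal_form_reduced w : K (word_val w) -> word_on X w -> reduced w ->
  normal_form w = w.
Proof.
move=> Kw hw rw; rewrite -reduced_word_val //.
have [w' [_ uniq_w']] := bX.2 _ Kw.
by rewrite -(uniq_w' _ (reduced_wordP Kw)); apply: uniq_w'.
Qed.

Lemma reduced_word_inj w w' : K (word_val w) -> word_on X w -> word_on X w' ->
  reduced w -> reduced w' -> word_val w = word_val w' -> w = w'.
Proof.
move=> Kw Xw Xw' rw rw' eww'; rewrite -(normal_form_reduced Kw) //.
by rewrite -reduced_word_val // eww' reduced_word_val ?normal_form_reduced // -eww'.
Qed.

Section Extension.
Variables (T : Type) (step : T -> F * bool -> T).
Hypothesis stepK : forall t a, X a.1 -> step (step t a) (letter_inv a) = t.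

(** The universal property in the form of an action: letters of [X] acting invertibly on [T] extend
    to all of [K]. *)
Definition extend_step t g := foldl step t (reduced_word g).

Lemma extend_step_word t w : K (word_val w) -> word_on X w ->
  extend_step t (word_val w) = foldl step t w.
Proof.
by move=> Kw hw; rewrite /extend_step reduced_word_val // (foldl_normal_form t stepK).
Qed.

Lemma extend_stepM t g h : K g -> K h -> K (g * h) ->
  extend_step t (g * h) = extend_step (extend_step t g) h.
Proof.
move=> Kg Kh Kgh; have [Xg _ eg] := reduced_wordP Kg.
have [Xh _ eh] := reduced_wordP Kh.
have egh : g * h = word_val (reduced_word g ++ reduced_word h).
  by rewrite word_val_cat eg eh.
rewrite {1}egh extend_step_word ?foldl_cat -?egh //.
exact/word_on_cat.
Qed.

End Extension.
End FreeBasis.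
End Words.

(** * A left order on a free group *)

Section LeftOrder.
Variable F : groupType.
Implicit Types (a b c : F * bool) (u v w p q : seq (F * bool)).

Let letter_le : rel (F * bool) := sval (well_ordering_principle (F * bool)%type).

Definition turn a b : int := if letter_le a b then 1%R else (-1)%R.

Definition letter_sign a : int := if a.2 then 1%R else (-1)%R.

Definition junction u v : int :=
  if (rev u, v) is (a :: _, b :: _) then turn (letter_inv a) b else 0%R.

(* The sum over a path of the signs of its letters and of its turns, where the
   directions at each vertex of the Cayley tree carry a translation invariant
   total order.  Around the median of three vertices these sums add up to 1 or
   -1, which makes [0 < path_weight] a positive cone (Dicks and Sunic). *)
Fixpoint path_weight w : int :=
  if w is a :: w' then
    (letter_sign a + junction [:: a] w' + path_weight w')%R
  else 0%R.

Lemma letter_le_min (s : seq (F * bool)) : s != [::] ->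
  exists2 a, a \in s & {in s, forall b, letter_le a b}.
Proof.
case: s => // a s _.
have ne : nonempty [in a :: s] by exists a; exact: mem_head.
have [b [[bs hb] _]] := svalP (well_ordering_principle (F * bool)%type) _ ne.
by exists b => //; exact: hb.
Qed.

Lemma letter_le_refl a : letter_le a a.
Proof.
have [b] := @letter_le_min [:: a] isT.
by rewrite inE => /eqP-> /(_ a); apply; rewrite inE.
Qed.

Lemma letter_le_anti a b : letter_le a b -> letter_le b a -> a = b.
Proof.
move=> ab ba; have ne : nonempty [in [:: a; b]] by exists a; exact: mem_head.
have [c [_ uc]] := svalP (well_ordering_principle (F * bool)%type) _ ne.
have umin d : d \in [:: a; b] -> letter_le d a -> letter_le d b -> c = d.
  move=> dab da db; apply: uc; split=> // e.
  by rewrite inE => /orP[/eqP->|]; rewrite ?inE //; move/eqP->.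
transitivity c; [symmetry|]; apply: umin => //; try exact: letter_le_refl.
  exact: mem_head.
by rewrite !inE eqxx orbT.
Qed.

Lemma turn_anti a b : a != b -> turn a b = (- turn b a)%R.
Proof.
move=> ab; rewrite /turn; case: ifP => leab; case: ifP => leba //.
  by rewrite (letter_le_anti leab leba) eqxx in ab.
have [c] := @letter_le_min [:: a; b] isT.
rewrite !inE => /orP[] /eqP-> cmin.
  by rewrite cmin ?inE ?eqxx ?orbT in leab.
by rewrite cmin ?inE ?eqxx ?orbT in leba.
Qed.

Lemma turn_cases a b : turn a b = 1%R \/ turn a b = (-1)%R.
Proof. by rewrite /turn; case: ifP; [left|right]. Qed.

(** Three distinct directions in a total order cannot increase or decrease cyclically, so the sum is
    never 3 or -3; its sign is their cyclic orientation. *)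
Lemma turn_cycle a b c : a != b -> b != c -> c != a ->
  let s := (turn a b + turn b c + turn c a)%R in (s = 1 \/ s = -1)%R.
Proof.
move=> ab bc ca /=; have tab := turn_anti ab; have tbc := turn_anti bc.
have tca := turn_anti ca.
have [d] := @letter_le_min [:: a; b; c] isT.
have t1 x y : letter_le x y -> turn x y = 1%R by rewrite /turn => ->.
rewrite !inE => /or3P[] /eqP-> dmin.
- have := t1 _ _ (dmin b _); have := t1 _ _ (dmin c _).
  rewrite !inE !eqxx ?orbT => /(_ isT) h1 /(_ isT) h2.
  by have := turn_cases b c; lia.
- have := t1 _ _ (dmin a _); have := t1 _ _ (dmin c _).
  rewrite !inE !eqxx ?orbT => /(_ isT) h1 /(_ isT) h2.
  by have := turn_cases c a; lia.
- have := t1 _ _ (dmin a _); have := t1 _ _ (dmin b _).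
  rewrite !inE !eqxx ?orbT => /(_ isT) h1 /(_ isT) h2.
  by have := turn_cases a b; lia.
Qed.

Lemma junction_bound u v : (-1 <= junction u v <= 1)%R.
Proof.
rewrite /junction; case: (rev u) => // a ?; case: v => // b ?.
by have := turn_cases (letter_inv a) b; lia.
Qed.

Lemma path_weight_cat u v :
  path_weight (u ++ v) = (path_weight u + junction u v + path_weight v)%R.
Proof.
elim: u => [|a u IH]; first by rewrite /junction /=; lia.
rewrite cat_cons /= IH; case: u IH => [|b u] _.
  by rewrite /= /junction /=; lia.
have -> : junction (a :: b :: u) v = junction (b :: u) v.
  rewrite /junction (rev_cons a) rev_cons.
  by case: (rev u).
by rewrite /junction /=; lia.
Qed.

Lemma path_weight_inv w : reduced w -> path_weight (word_inv w) = (- path_weight w)%R.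
Proof.
elim: w => [|a w IH] //; rewrite reduced_cons word_inv_cons -cats1 path_weight_cat.
move=> /andP[haw rw]; rewrite IH //=.
have -> : letter_sign (letter_inv a) = (- letter_sign a)%R.
  by case: a {haw} => x [].
case: w rw haw {IH} => [|b w] _ haw; first by rewrite /junction /=; lia.
rewrite /junction /word_inv revK map_cons letter_invK /=.
by rewrite (turn_anti haw); lia.
Qed.

(** A word of n letters has n letter signs and n - 1 turns, an odd number of terms 1 or -1. Hence a
    nonempty word never has weight 0. *)
Lemma path_weight_odd w : w != [::] -> exists k : int, path_weight w = (2 * k + 1)%R.
Proof.
elim: w => [|a w IH] // _.
have [k hk] : exists k, letter_sign a = (2 * k + 1)%R.
  by rewrite /letter_sign; case: a.2; [exists 0%R|exists (-1)%R].
case: w IH => [_|b w /(_ isT)[l hl]]; first by exists k; rewrite /= hk /junction /=; lia.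
rewrite [path_weight _]/= -/(path_weight (b :: w)) hl hk.
have [t1|t1] := turn_cases (letter_inv a) b; rewrite /junction /= t1.
  by exists (k + l + 1)%R; lia.
by exists (k + l)%R; lia.
Qed.

Lemma cancellation u v : reduced u -> reduced v ->
  exists p q w, [/\ u = p ++ w, v = word_inv w ++ q & reduced (p ++ q)].
Proof.
elim/last_ind: u v => [|u a IH] v ru rv; first by exists [::], v, [::].
have irr : ~~ (if v is b :: _ then b == letter_inv a else false) ->
    exists p q w, [/\ rcons u a = p ++ w, v = word_inv w ++ q & reduced (p ++ q)].
  move=> h; exists (rcons u a), v, [::]; split; rewrite ?cats0 //.
  rewrite reduced_cat ru rv rev_rcons /=.
  by case: v h {IH rv}.
case: v rv irr => [|b v] rv irr; first exact: irr.
have [eb|nb] := eqVneq b (letter_inv a); last exact: irr.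
have [||p [q [w [-> -> rpq]]]] := IH v.
- by move: ru; rewrite -cats1 => /reduced_catl.
- by move: rv; rewrite reduced_cons => /andP[].
exists p, q, (rcons w a); rewrite rcons_cat; split => //.
by rewrite -cats1 word_inv_cat /= eb.
Qed.

(** The legs [p], [w] and [q] meet at one vertex of the Cayley tree. Their own weights cancel, and
    the turns left at that vertex are bounded by [turn_cycle]. The loss of 1 is harmless, as
    positive weights are at least 1. *)
Lemma path_weight_cancel p q w :
    reduced (p ++ w) -> reduced (word_inv w ++ q) -> reduced (p ++ q) ->
  (path_weight (p ++ w) + path_weight (word_inv w ++ q) - 1 <= path_weight (p ++ q))%R.
Proof.
move=> rpw rwq rpq; rewrite !path_weight_cat path_weight_inv; last first.
  exact: reduced_catr rpw.
have jpq := junction_bound p q; have jpw := junction_bound p w.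
have jwq := junction_bound (word_inv w) q.
have j0l v : junction [::] v = 0%R by [].
have j0r u : junction u [::] = 0%R by rewrite /junction; case: (rev u).
have [w0|nw] := eqVneq w [::].
  by rewrite w0 /word_inv /= !j0l j0r /=; lia.
have [p0|np] := eqVneq p [::]; first by rewrite p0 !j0l /=; lia.
have [q0|nq] := eqVneq q [::]; first by rewrite q0 !j0r /=; lia.
case: w nw rpw rwq {jwq jpw jpq} => // c w _; case/lastP: p np rpq => // p a _ rpq rpw.
case: q nq rpq => // b q _ rpq rwq.
have ba : b != letter_inv a by move: rpq; rewrite reduced_cat rev_rcons /= => /and3P[].
have ca : c != letter_inv a by move: rpw; rewrite reduced_cat rev_rcons /= => /and3P[].
have bc : b != c.
  move: rwq; rewrite reduced_cat /word_inv revK map_cons => /and3P[_ _].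
  by rewrite letter_invK.
rewrite /junction rev_rcons /word_inv revK map_cons letter_invK.
have := turn_cycle ca; have := turn_anti bc; have := turn_anti ba.
rewrite eq_sym in ba; move=> e1 e2 /(_ b ba bc) /=; rewrite (turn_anti ca) e2.
lia.
Qed.

Variable X : set F.
Hypothesis bX : free_basis setT X.

(** The positive cone consists of the elements whose reduced word has positive weight.
    [path_weight_cancel] closes it under products; oddness and [path_weight_inv] put [g] or its
    inverse in it when [g] is not 1. *)
Lemma free_left_order : exists lt : rel F,
  [/\ irreflexive lt, transitive lt, forall g h, g != h -> lt g h || lt h g
    & forall k g h, lt (k * g) (k * h) = lt g h].
Proof.
pose pos g := (0 < path_weight (reduced_word X g))%R.
have rw g := reduced_wordP bX (I : [set: F] g).
have posM g h : pos g -> pos h -> pos (g * h).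
  have [Xg rg eg] := rw g; have [Xh rh eh] := rw h.
  have [p [q [w [epw ewq rpq]]]] := cancellation rg rh.
  have [Xp Xw] : word_on X p /\ word_on X w by apply/word_on_cat; rewrite -epw.
  have [_ Xq] : word_on X (word_inv w) /\ word_on X q.
    by apply/word_on_cat; rewrite -ewq.
  have egh : g * h = word_val (p ++ q).
    by rewrite -eg -eh epw ewq !word_val_cat word_val_inv mulgA mulgK.
  have Xpq : word_on X (p ++ q) by apply/word_on_cat.
  rewrite epw in rg; rewrite ewq in rh.
  rewrite /pos egh (reduced_word_val bX) // (normal_form_reduced bX) // epw ewq.
  by have := path_weight_cancel rg rh rpq; lia.
have pos1 : pos 1 = false.
  by rewrite /pos -word_val_nil (reduced_word_val bX).
have posV g : g != 1 -> pos g || pos g^-1.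
  move=> g1; have [Xg rg eg] := rw g; rewrite /pos.
  have -> : reduced_word X g^-1 = word_inv (reduced_word X g).
    rewrite -{1}eg -word_val_inv (reduced_word_val bX) ?(normal_form_reduced bX) //;
      by [exact: word_on_inv | exact: reduced_inv].
  rewrite path_weight_inv //; have [|k ->] := @path_weight_odd (reduced_word X g).
    by apply: contra_neq g1 => h; rewrite -eg h word_val_nil.
  lia.
exists (fun g h => pos (g^-1 * h)); split.
- by move=> g; rewrite mulVg.
- by move=> h g k gh hk; have := posM _ _ gh hk; rewrite -mulgA mulVKg.
- move=> g h gh; rewrite -[h^-1 * g]invgK invgM invgK; apply: posV.
  by rewrite mulg_eq1 eqg_inv.
- by move=> k g h; rewrite invgM -mulgA mulKg.
Qed.
End LeftOrder.

(** * Counting in Schreier graphs *)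

(** Functions on a finite set can be counted; extended by [false] they become cochains on all
    edges. *)
Definition zero_ext (I : choiceType) (D : {fset I}) (f : {ffun D -> bool}) i : bool :=
  if insub i is Some j then f j else false.

Lemma zero_extE (I : choiceType) (D : {fset I}) (f : {ffun D -> bool}) (i : D) :
  zero_ext f (val i) = f i.
Proof. by rewrite /zero_ext valK. Qed.

Lemma zero_extN (I : choiceType) (D : {fset I}) (f : {ffun D -> bool}) i :
  i \notin D -> zero_ext f i = false.
Proof. by move=> iD; rewrite /zero_ext insubN. Qed.

Section Action.
Variables (F : groupType) (V : choiceType) (act : V -> F -> V).
Hypotheses (act1 : forall v, act v 1 = v)
  (actM : forall v g h, act (act v g) h = act v (g * h)).
Implicit Types (v s : V) (g h : F) (a : F * bool) (w : seq (F * bool)).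
Implicit Types (e : V * F) (c : V * F -> bool).

(* The pair (s, y) is the edge from s to [act s y]; a negative letter runs
   through an edge backwards. *)
Definition tip e := act e.1 e.2.

Definition letter_edge v a : V * F :=
  if a.2 then (v, a.1) else (act v (letter_val a), a.1).

Fixpoint trace v w : seq (V * F) :=
  if w is a :: w' then letter_edge v a :: trace (act v (letter_val a)) w' else [::].

Lemma actK g : cancel (act^~ g) (act^~ g^-1).
Proof. by move=> v; rewrite actM mulgV act1. Qed.

Lemma actVK g : cancel (act^~ g^-1) (act^~ g).
Proof. by move=> v; rewrite actM mulVg act1. Qed.

Lemma letter_edge_inv v a :
  letter_edge (act v (letter_val a)) (letter_inv a) = letter_edge v a.
Proof. by case: a => x []; rewrite /letter_edge letter_val_inv actM mulgV act1. Qed.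

Lemma letter_edge_ends v a :
  (letter_edge v a).1 = v /\ tip (letter_edge v a) = act v (letter_val a) \/
  tip (letter_edge v a) = v /\ (letter_edge v a).1 = act v (letter_val a).
Proof.
case: a => x []; rewrite /letter_edge /tip /letter_val /=; first by left.
by right; rewrite actVK.
Qed.

Lemma trace_cat v w w' : trace v (w ++ w') = trace v w ++ trace (act v (word_val w)) w'.
Proof.
elim: w v => [|a w IH] v /=; first by rewrite word_val_nil act1.
by rewrite IH actM word_val_cons.
Qed.

(** Modulo 2, the direction in which an edge is crossed does not matter. *)
Definition parity c (l : seq (V * F)) : bool := foldr (fun e b => c e (+) b) false l.

Section Cocycle.
Variables (K X : set F) (bX : free_basis K X).

(** The state is a vertex with a running sum modulo 2. Crossing an edge back restores both, so
    [extend_step_word] and [extend_stepM] apply. *)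
Definition cocycle_step c (t : V * bool) a : V * bool :=
  (act t.1 (letter_val a), t.2 (+) c (letter_edge t.1 a)).

Lemma cocycle_stepK c t a : cocycle_step c (cocycle_step c t a) (letter_inv a) = t.
Proof.
case: t => v b; rewrite /cocycle_step /= letter_edge_inv letter_val_inv actK.
by rewrite addbK.
Qed.

Lemma foldl_cocycle_step c v b w :
  foldl (cocycle_step c) (v, b) w = (act v (word_val w), b (+) parity c (trace v w)).
Proof.
elim: w v b => [|a w IH] v b /=; first by rewrite word_val_nil act1 addbF.
by rewrite IH /= actM -word_val_cons addbA.
Qed.

Definition cocycle c v g : bool := parity c (trace v (reduced_word X g)).

Lemma cocycle_word c v w : K (word_val w) -> word_on X w ->
  cocycle c v (word_val w) = parity c (trace v w).
Proof.
move=> Kw Xw.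
have := extend_step_word bX (fun t a _ => cocycle_stepK c t a) (v, false) Kw Xw.
by rewrite /extend_step !foldl_cocycle_step => -[_].
Qed.

Lemma cocycleM c v g h : K g -> K h -> K (g * h) ->
  cocycle c v (g * h) = cocycle c v g (+) cocycle c (act v g) h.
Proof.
move=> Kg Kh Kgh.
have := extend_stepM bX (fun t a _ => cocycle_stepK c t a) (v, false) Kg Kh Kgh.
rewrite /extend_step !foldl_cocycle_step => -[_].
by have [_ _ ->] := reduced_wordP bX Kg.
Qed.

Lemma cocycle1 c v : K 1 -> cocycle c v 1 = false.
Proof. by rewrite -word_val_nil => K1; rewrite cocycle_word. Qed.

Lemma cocycle_basis c v x : X x -> cocycle c v x = c (v, x).
Proof.
move=> Xx; have ex : x = word_val [:: (x, true)].
  by rewrite word_val_cons word_val_nil mulg1.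
rewrite [in LHS]ex cocycle_word -?ex //=; first by rewrite addbF.
- exact: bX.1.
- exact/word_on_cons.
Qed.

End Cocycle.

(* A mod 2 cochain on E is determined by the morphism that it induces on the
   stabilizer of v0 and by its sums along chosen paths from v0 to the vertices. *)
Lemma euler_upper (v0 : V) (S : {fset V}) (E : {fset V * F}) (X : set F)
    (B : {fset F}) :
    v0 \in S -> free_basis setT X ->
    (forall g, act v0 g = v0 -> exists2 w, word_on [set` B] w & word_val w = g) ->
    (forall b, b \in B -> act v0 b = v0) ->
    (forall s, s \in S -> exists g, act v0 g = s) ->
    (forall e, e \in E -> [/\ X e.2, e.1 \in S & tip e \in S]) ->
  (#|` E| + 1 <= #|` B| + #|` S|)%N.
Proof.
move=> Sv0 bX Bgen Bstab Strans EX.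
(* The path chosen to [v0] is trivial, so [v0] carries no free parameter; this accounts for the 1 in
   the inequality. *)
have sec_ex s : exists g, s \in S -> act v0 g = s /\ (s = v0 -> g = 1).
  have [->|nv0] := eqVneq s v0; first by exists 1; rewrite act1.
  have [sS|] := boolP (s \in S); last by exists 1.
  by have [g gs] := Strans s sS; exists g => _; split=> // s0; rewrite s0 eqxx in nv0.
pose sec s := sval (cid (sec_ex s)).
have secE s : s \in S -> act v0 (sec s) = s by rewrite /sec; case: cid => g /= h /h[].
have sec1 : sec v0 = 1 by rewrite /sec; case: cid => g /= /(_ Sv0)[_]; apply.
pose coc (f : {ffun E -> bool}) g := cocycle X (zero_ext f) v0 g.
pose R := (S `\ v0)%fset.
pose Phi (f : {ffun E -> bool}) : {ffun B -> bool} * {ffun R -> bool} :=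
  ([ffun b : B => coc f (val b)], [ffun s : R => coc f (sec (val s))]).
have T g : setT g by [].
have Phi_inj : injective Phi.
  move=> f1 f2 [] /ffunP eB /ffunP eR.
  (* The elements of [B] fix [v0], and the cocycle is additive on the stabilizer, so its values on
     [B] determine it there. *)
  have sB w : word_on [set` B] w -> coc f1 (word_val w) = coc f2 (word_val w).
    elim: w => [|a w IH] Bw; first by rewrite word_val_nil /coc !(cocycle1 bX).
    have [Ba /IH {}IH] := (word_on_cons _ _ _).1 Bw.
    have eqa : coc f1 (letter_val a) = coc f2 (letter_val a)
        /\ act v0 (letter_val a) = v0.
      have e1 : coc f1 a.1 = coc f2 a.1.
        by have := eB [` Ba]%fset; rewrite !ffunE.
      rewrite /letter_val; case: a.2; first by rewrite Bstab.
      have st : act v0 a.1^-1 = v0 by rewrite -{1}(Bstab _ Ba) actK.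
      split=> //; apply: (@addbI (coc f1 a.1)); rewrite {2}e1.
      have := cocycleM bX (zero_ext f1) v0 (T a.1) (T a.1^-1) (T _).
      have := cocycleM bX (zero_ext f2) v0 (T a.1) (T a.1^-1) (T _).
      by rewrite mulgV !(cocycle1 bX) // Bstab // /coc => <- <-.
    have [{}eqa sta] := eqa.
    by rewrite word_val_cons /coc !(cocycleM bX) // sta -!/(coc _ _) eqa IH.
  have sS s : s \in S -> coc f1 (sec s) = coc f2 (sec s).
    move=> sS; have [->|nv0] := eqVneq s v0; first by rewrite sec1 /coc !(cocycle1 bX).
    have sR : s \in R by rewrite !inE nv0.
    by have := eR [` sR]%fset; rewrite !ffunE.
  apply/ffunP => e; have [Xe eS teS] := EX _ (valP e).
  (* Closing the edge by chosen paths gives a loop at [v0], so [f e] is recovered from the sums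
     along this loop and the two paths. *)
  pose g := sec (val e).1 * (val e).2 * (sec (tip (val e)))^-1.
  have stg : act v0 g = v0.
    rewrite -!actM secE // -[act (val e).1 _]/(tip _) -{1}(secE _ teS).
    by rewrite actK.
  have [w Bw eg] := Bgen g stg.
  have ef (f : {ffun E -> bool}) : f e =
      coc f (sec (val e).1) (+) (coc f g (+) coc f (sec (tip (val e)))).
    rewrite -zero_extE [in LHS](surjective_pairing (val e)).
    rewrite -(cocycle_basis bX) // -{1}(secE _ eS).
    have := cocycleM bX (zero_ext f) v0 (T g) (T (sec (tip (val e)))) (T _).
    rewrite stg -!/(coc _ _) => <-; rewrite /g mulgVK /coc (cocycleM bX) //.
    by rewrite addKb.
  by rewrite !ef -eg (sB w) // !sS.
have := leq_card Phi Phi_inj.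
rewrite card_prod !card_ffun !card_bool -expnD leq_exp2l // -!cardfE.
by have := cardfsD1 v0 S; rewrite Sv0 -/R; lia.
Qed.

End Action.

Section BooleanMorphism.
Variables (F : groupType) (K A : set F).
Hypotheses (bA : free_basis K A) (sK : is_subgroup K).

(** With a single vertex every path is a loop, and the cocycle becomes a morphism from [K] to the
    integers modulo 2 with prescribed values on [A]. *)
Definition boolean_morphism (c : F -> bool) : F -> bool :=
  cocycle (fun (_ : unit) (_ : F) => tt) A (fun e => c e.2) tt.

Let trivial1 (v : unit) : (fun=> tt) (1 : F) = v. Proof. by case: v. Qed.

Lemma boolean_morphismM c g h : K g -> K h ->
  boolean_morphism c (g * h) = boolean_morphism c g (+) boolean_morphism c h.
Proof.
move=> Kg Kh; rewrite /boolean_morphism (cocycleM trivial1 _ bA) //.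
by apply/set_mem/(group_closedM sK); apply/mem_set.
Qed.

Lemma boolean_morphismV c g : K g -> boolean_morphism c g^-1 = boolean_morphism c g.
Proof.
move=> Kg; have K1 : K 1 by apply/set_mem; case: sK.
have KV : K g^-1 by apply/set_mem/(group_closedV sK)/mem_set.
apply: (@addbI (boolean_morphism c g)); rewrite -boolean_morphismM // mulgV addbb.
exact: (cocycle1 trivial1 _ bA).
Qed.

Lemma boolean_morphism_basis c a : A a -> boolean_morphism c a = c a.
Proof. by move=> Aa; exact: (cocycle_basis trivial1 _ bA). Qed.

End BooleanMorphism.

Section EulerLower.
Variables (F : groupType) (V : choiceType) (act : V -> F -> V).
Hypotheses (act1 : forall v, act v 1 = v)
  (actM : forall v g h, act (act v g) h = act v (g * h)).
Variables (v0 : V) (S : {fset V}) (E : {fset V * F}) (K H A : set F) (A' : {fset F}).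
Hypotheses (bA : free_basis K A) (sH : is_subgroup H)
  (KE : forall g, K g <-> H g /\ act v0 g = v0) (AA' : [set` A'] `<=` A)
  (Sv0 : v0 \in S) (Strans : forall s, s \in S -> exists2 h, H h & act v0 h = s)
  (EH : forall e, e \in E -> [/\ H e.2, e.1 \in S & tip act e \in S]).

Let HM g h : H g -> H h -> H (g * h).
Proof. by move=> Hg Hh; apply/set_mem/(group_closedM sH); apply/mem_set. Qed.

Let HV g : H g -> H g^-1.
Proof. by move=> Hg; apply/set_mem/(group_closedV sH)/mem_set. Qed.

Let H1 : H 1. Proof. by apply/set_mem; case: sH. Qed.

Let sK : is_subgroup K.
Proof.
split=> [|g h /set_mem/KE[Hg gv] /set_mem/KE[Hh hv]]; apply/mem_set/KE.
  by split; [exact: H1|exact: act1].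
by split; [apply/HM/HV|rewrite -actM gv -{1}hv actM mulgV act1].
Qed.

(* A Boolean function on A' extends to a morphism on K, hence to a mod 2 cochain
   on E, whose sums along the loops of A' are not changed by coboundaries. *)
Lemma euler_lower :
    (forall p : V -> bool, (forall e, e \in E -> p e.1 = p (tip act e)) ->
      forall s, s \in S -> p s = p v0) ->
    (forall a, a \in A' ->
      exists2 w, word_val w = a & {subset trace act v0 w <= E}) ->
  (#|` A'| + #|` S| <= #|` E| + 1)%N.
Proof.
move=> connE traceA.
have sec_ex s : exists h, s \in S -> [/\ H h, act v0 h = s & s = v0 -> h = 1].
  have [->|nv0] := eqVneq s v0; first by exists 1 => _; split.
  have [sS|] := boolP (s \in S); last by exists 1.
  by have [h Hh hs] := Strans sS; exists h => _; split=> // s0; rewrite s0 eqxx in nv0.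
pose sec s := sval (cid (sec_ex s)).
have secH s : s \in S -> H (sec s) by rewrite /sec; case: cid => h /= P /P[].
have secE s : s \in S -> act v0 (sec s) = s by rewrite /sec; case: cid => h /= P /P[].
have sec1 : sec v0 = 1 by rewrite /sec; case: cid => h /= /(_ Sv0)[_ _]; apply.
pose R := (S `\ v0)%fset.
pose loop s g := sec s * g * (sec (act s g))^-1.
have loopK s g : s \in S -> act s g \in S -> H g -> K (loop s g).
  move=> sS gS Hg; apply/KE; split; first by do ?[apply: HM|apply: HV]; auto.
  by rewrite -!actM secE // -{1}(secE _ gS) actM mulgV act1.
(* The morphism extending [t] is pulled back to edges through [loop], and the coboundary of [p] is
   added. *)
pose c (t : {ffun A' -> bool}) (p : {ffun R -> bool}) e :=
  boolean_morphism A (zero_ext t) (loop e.1 e.2) (+)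
  (zero_ext p e.1 (+) zero_ext p (tip act e)).
have pv0 (p : {ffun R -> bool}) : zero_ext p v0 = false.
  by rewrite zero_extN // !inE eqxx.
(* The loops multiply along a path, and the coboundary telescopes. *)
have c_trace t p v w : v \in S -> {subset trace act v w <= E} ->
    [/\ act v (word_val w) \in S, H (word_val w) & parity (c t p) (trace act v w) =
    boolean_morphism A (zero_ext t) (loop v (word_val w)) (+)
    (zero_ext p v (+) zero_ext p (act v (word_val w)))].
  elim: w v => [|a w IH] v vS /= sub.
    rewrite word_val_nil act1 addbb /loop act1 mulg1 mulgV; split=> //.
    rewrite /boolean_morphism (cocycle1 _ _ bA) //; first by case.
    by apply/KE.
  have vaE : letter_edge act v a \in E by rewrite sub ?mem_head.
  have [Ha eS teS] := EH vaE.
  have HLa : H (letter_val a).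
    move: Ha; rewrite /letter_edge /letter_val.
    by case: a.2 => //= /HV.
  have aS : act v (letter_val a) \in S.
    by have [[_ <-]|[_ <-]] := letter_edge_ends act1 actM v a.
  have [|wS Hw ->] := IH _ aS; first by move=> e ew; apply: sub; rewrite inE ew orbT.
  rewrite word_val_cons -actM; split=> //; first exact: HM.
  have -> : loop v (letter_val a * word_val w)
      = loop v (letter_val a) * loop (act v (letter_val a)) (word_val w).
    by rewrite /loop actM !mulgA mulgVK.
  rewrite (boolean_morphismM bA) //; try exact: loopK.
  have -> : c t p (letter_edge act v a) =
      boolean_morphism A (zero_ext t) (loop v (letter_val a)) (+)
      (zero_ext p v (+) zero_ext p (act v (letter_val a))).
    case: a {sub vaE IH wS} Ha eS teS HLa aS => x [] //= Ha eS teS HLa aS.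
    rewrite /c /tip /letter_edge /letter_val /= actM mulVg act1.
    rewrite [zero_ext p v (+) _]addbC; congr (_ (+) _).
    rewrite -(boolean_morphismV bA) //; last first.
      by apply: loopK => //; rewrite actM mulVg act1.
    by rewrite /loop actM mulVg act1 !invgM invgK !mulgA.
  by do 2 case: (boolean_morphism _ _ _); do 3 case: (zero_ext _ _).
pose Phi (tp : {ffun A' -> bool} * {ffun R -> bool}) : {ffun E -> bool} :=
  [ffun e => c tp.1 tp.2 (val e)].
have Phi_inj : injective Phi.
  move=> [t1 p1] [t2 p2] /ffunP eqc.
  have {}eqc e : e \in E -> c t1 p1 e = c t2 p2 e.
    by move=> eE; have := eqc [` eE]%fset; rewrite !ffunE.
  (* Along a loop of [A'] the coboundary cancels, so the sum returns the value of [t]. *)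
  have et : t1 = t2.
    apply/ffunP => a; have [w wa sub] := traceA _ (valP a).
    have Aa : A (val a) by apply: AA'; exact: valP.
    have [_ av0] : H (val a) /\ act v0 (val a) = v0 by apply/KE/bA.1.
    have par t p : parity (c t p) (trace act v0 w) = t a.
      have [_ _ ->] := c_trace t p v0 w Sv0 sub.
      rewrite wa /loop av0 sec1 mul1g invg1 mulg1 addbb addbF.
      by rewrite (boolean_morphism_basis bA) // zero_extE.
    rewrite -(par _ p1) -(par _ p2); elim: (trace _ _ _) sub => //= e l IH sub.
    rewrite IH; first by rewrite eqc // sub ?mem_head.
    by move=> e' e'l; apply: sub; rewrite inE e'l orbT.
  congr (_, _) => //; apply/ffunP => s.
  have [nv0 sS] : val s != v0 /\ val s \in S by apply/andP; have := valP s; rewrite !inE.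
  (* Once [t1 = t2], the difference of [p1] and [p2] is constant along edges, hence equal to its
     value [false] at [v0]. *)
  pose p s := zero_ext p1 s (+) zero_ext p2 s.
  have : p (val s) = p v0.
    apply: connE => // e eE; have := eqc e eE; rewrite /c et => /addbI.
    rewrite /p; do 4 case: (zero_ext _ _) => //.
  by rewrite /p !pv0 !zero_extE; case: (p1 s) (p2 s) => [] [].
have := leq_card Phi Phi_inj.
rewrite card_prod !card_ffun !card_bool -expnD leq_exp2l // -!cardfE.
by have := cardfsD1 v0 S; rewrite Sv0 -/R; lia.
Qed.
End EulerLower.

(** * Tree components of a finite graph *)

Section TreeComponent.
Variables (F : groupType) (V : choiceType) (act : V -> F -> V).
Local Notation tip := (tip act).

(* A connected component with fewer edges than vertices is a tree, hence lifts
   to the Cayley graph.  Edges in [Q] may have one end, or both, outside [Z]. *)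
Lemma tree_component (Z : {fset V}) (Q : {fset V * F}) : (#|` Q| < #|` Z|)%N ->
  exists (C : {fset V}) (lift : V -> F), [/\ C != fset0, (C `<=` Z)%fset &
    forall e, e \in Q -> e.1 \in C \/ tip e \in C ->
      [/\ e.1 \in C, tip e \in C & lift (tip e) = lift e.1 * e.2]].
Proof.
move: {2}#|` Z|.+1 (ltnSn #|` Z|) => n; elim: n Z Q => // n IH Z Q ltZn ltQZ.
pose ends z (e : V * F) := ((e.1 == z) + (tip e == z))%N.
pose deg z := (\sum_(e <- Q) ends z e)%N.
(* The degrees, with a loop counted twice, sum to at most 2 |Q| < 2 |Z|, so some vertex of [Z] has
   degree at most 1. *)
have [z zZ degz] : exists2 z, z \in Z & (deg z <= 1)%N.
  have [/hasP//|/hasPn degZ] := boolP (has (fun z => deg z <= 1)%N Z).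
  have cnt v : (\sum_(z <- Z) (v == z) <= 1)%N.
    have -> : (\sum_(z <- Z) (v == z) = count (pred1 v) Z)%N.
      rewrite -sum1_count [RHS]big_mkcond; apply: eq_bigr => z _ /=.
      by rewrite eq_sym; case: eqP.
    by rewrite count_uniq_mem ?fset_uniq //; case: (v \in _).
  have sum2 (T : Type) (s : seq T) : (\sum_(i <- s) 2 = 2 * size s)%N.
    by rewrite big_const_seq count_predT iter_addn_0.
  suff : (2 * #|` Z| <= 2 * #|` Q|)%N by lia.
  apply: (@leq_trans (\sum_(z <- Z) deg z)).
    rewrite -[#|` Z|]/(size Z) -sum2 big_seq [in leqRHS]big_seq.
    by apply: leq_sum => z /degZ; rewrite -ltnNge.
  rewrite exchange_big /= -[#|` Q|]/(size Q) -sum2.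
  apply: leq_sum => e _; rewrite big_split /=.
  by have := cnt e.1; have := cnt (tip e); lia.
have [noe|] := boolP (all (fun e => ends z e == 0%N) Q).
  exists [fset z]%fset, (fun=> 1); split.
  - by apply/fset0Pn; exists z; rewrite inE.
  - by rewrite fsub1set.
  - move=> e /(allP noe); rewrite /ends !inE.
    by rewrite addn_eq0 !eqb0 => /andP[/negbTE-> /negbTE->] [].
move=> /allPn[e eQ ez].
have others e' : e' \in Q -> e' != e -> e'.1 != z /\ tip e' != z.
  move=> e'Q ne; move: degz.
  rewrite /deg (bigD1_seq e) ?fset_uniq //= (big_rem e') //= ne.
  move: ez; rewrite /ends; do 2 case: (_ == z); do 2 case: (_ == z) => //; lia.
have onez : ends z e = 1%N.
  apply/eqP; rewrite eqn_leq lt0n ez andbT; apply: leq_trans degz.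
  by rewrite /deg (bigD1_seq e) ?fset_uniq //= leq_addr.
have cZ := cardfsD1 z Z; have cQ := cardfsD1 e Q; rewrite zZ in cZ; rewrite eQ in cQ.
(* Removing the leaf [z] with its edge [e] keeps the strict inequality. *)
have [||C [lift [C0 CZ Ccl]]] := IH (Z `\ z)%fset (Q `\ e)%fset; [lia|lia|].
have zC : z \notin C.
  by apply/negP => /(fsubsetP CZ); rewrite !inE eqxx.
have CZ' : (C `<=` Z)%fset by apply: fsubset_trans CZ _; exact: fsubsetDl.
have Ccl' e' : e' \in Q -> e' != e -> e'.1 \in C \/ tip e' \in C ->
    [/\ e'.1 \in C, tip e' \in C & lift (tip e') = lift e'.1 * e'.2].
  by move=> e'Q ne; apply: Ccl; rewrite !inE ne.
have [/orP eC|/norP[e1C teC]] := boolP ((e.1 \in C) || (tip e \in C)); last first.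
  exists C, lift; split=> // e' e'Q; have [-> []|ne] := eqVneq e' e.
  - by rewrite (negbTE e1C).
  - by rewrite (negbTE teC).
  - exact: Ccl'.
(* The leaf joins [C], and [e] dictates its lift from that of the other end. *)
exists (z |` C)%fset, (fun v => if v == z then
   (if e.1 == z then lift (tip e) * e.2^-1 else lift e.1 * e.2) else lift v); split.
- by apply/fset0Pn; exists z; rewrite !inE eqxx.
- by rewrite fsubUset fsub1set zZ.
move=> e' e'Q; have [->|ne] := eqVneq e' e.
  move=> _; move: onez; rewrite /ends !inE.
  have [e1z|e1z] := eqVneq e.1 z; have [tez|tez] := eqVneq (tip e) z => //= _.
    move: eC; rewrite e1z (negbTE zC) => -[//|->]; split=> //.
    by rewrite mulgVK.
  by move: eC; rewrite tez (negbTE zC) => -[->|//].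
have [n1 n2] := others _ e'Q ne; rewrite !inE (negbTE n1) (negbTE n2) /=.
exact: Ccl'.
Qed.

End TreeComponent.

(** * The comparison of ranks *)

Lemma exists_minimal (T : eqType) (lt : rel T) (s : seq T) :
  irreflexive lt -> transitive lt -> s != [::] ->
  exists2 m, m \in s & {in s, forall t, ~~ lt t m}.
Proof.
move=> ltxx lt_trans; elim: s => // t s IH _.
have [->|/IH[m ms mmin]] := eqVneq s [::].
  by exists t; rewrite ?mem_head // => u; rewrite inE => /eqP->; rewrite ltxx.
have [ltm|nltm] := boolP (lt t m); last first.
  by exists m; [rewrite inE ms orbT|move=> u; rewrite inE => /orP[/eqP->|/mmin]].
exists t; first exact: mem_head.
move=> u; rewrite inE => /orP[/eqP->|us]; first by rewrite ltxx.
by apply: contra (mmin u us) => ut; exact: lt_trans ltm.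
Qed.

(** * Positions of a letter in a reduced word *)

Section LetterPosition.
Variables (F : groupType) (X : set F).
Hypothesis bX : free_basis setT X.
Implicit Types (a b : F * bool) (u v w l : seq (F * bool)).

(* The edge of the Cayley graph crossed by the letter [a] of [l ++ a :: _]
   starts at [letter_base l a]. *)
Definition letter_shift a : F := if a.2 then 1 else letter_val a.
Definition letter_base l a : F := word_val l * letter_shift a.

Lemma reduced_val1 u : word_on X u -> reduced u -> word_val u = 1 -> u = [::].
Proof.
move=> Xu ru u1; apply: (reduced_word_inj bX) => //.
by rewrite u1 word_val_nil.
Qed.

(** A reduced path in the Cayley tree crosses no edge twice. *)
Lemma letter_base_inj l1 a l2 l1' a' l2' : word_on X (l1 ++ a :: l2) ->
    reduced (l1 ++ a :: l2) -> l1 ++ a :: l2 = l1' ++ a' :: l2' -> a.1 = a'.1 ->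
  letter_base l1 a = letter_base l1' a' -> size l1 = size l1'.
Proof.
suff H l3 b l4 l3' b' l4' : word_on X (l3 ++ b :: l4) -> reduced (l3 ++ b :: l4) ->
    l3 ++ b :: l4 = l3' ++ b' :: l4' -> b.1 = b'.1 ->
    letter_base l3 b = letter_base l3' b' -> (size l3 < size l3')%N -> False.
  move=> Xl rl e ea eb; case: (ltngtP (size l1) (size l1')) => // lt.
    by case: (H _ _ _ _ _ _ Xl rl e ea eb lt).
  by case: (H l1' a' l2' l1 a l2) => //; rewrite -e.
move=> Xl rl e eb ebase lt.
have [m em] : exists m, l3' = l3 ++ b :: m.
  have := congr1 (take (size l3')) e; rewrite [RHS]take_size_cat // => <-.
  exists (take (size l3' - size l3).-1 l4); rewrite take_cat ltnNge (ltnW lt) /=.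
  by rewrite -{1}(prednK (n := size l3' - size l3)) // subn_gt0.
have el : b :: l4 = b :: m ++ b' :: l4'.
  move: e; rewrite em -catA => /(congr1 (drop (size l3))).
  by rewrite !drop_size_cat.
have Xb : word_on X (b :: m ++ b' :: l4').
  by rewrite -el; have [] := (word_on_cat _ _ _).1 Xl.
have rb : reduced (b :: m ++ b' :: l4') by rewrite -el; exact: reduced_catr rl.
move: ebase; rewrite em /letter_base word_val_cat word_val_cons -!mulgA => /mulgI.
(* For each pair of signs, two crossings of one edge bound a reduced word of value 1, hence an empty
   one. Only for a negative [b] and a positive [b'] can it be empty, and then these letters are
   adjacent inverses. *)
rewrite /letter_shift; case sb : b.2; case sb' : b'.2; rewrite ?mulg1 => /esym.
- rewrite -word_val_cons => /reduced_val1 h; suff : b :: m = [::] by [].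
  move: Xb rb; rewrite -cat_cons => /word_on_cat[Xm _] /reduced_catl rm.
  exact: h.
- rewrite -word_val_rcons -word_val_cons => /reduced_val1 h.
  suff : b :: rcons m b' = [::] by [].
  move: Xb rb; rewrite -cat_rcons -cat_cons => /word_on_cat[Xm _] /reduced_catl rm.
  exact: h.
- rewrite -[RHS]mulg1 => /mulgI /reduced_val1 h.
  have m0 : m = [::].
    move/word_on_cons: Xb => [_ /word_on_cat[Xm _]].
    by move: rb; rewrite reduced_cons => /andP[_ /reduced_catl rm]; exact: h.
  move: rb; rewrite m0 cat0s reduced_cons => /andP[/eqP[]].
  by rewrite /letter_inv eb sb /= -sb'; case: (b').
- rewrite -[RHS]mulg1 => /mulgI; rewrite -word_val_rcons => /reduced_val1 h.
  suff : rcons m b' = [::] by case: (m).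
  move: Xb rb; rewrite -cat_rcons reduced_cons.
  move=> /word_on_cons[_ /word_on_cat[Xm _]] /andP[_ /reduced_catl rm]; exact: h.
Qed.

(** By [letter_base_inj] the [x]-edges of the path are distinct, so the largest one is strictly
    above the others. *)
Lemma exists_top_letter (lt : rel F) x w : irreflexive lt -> transitive lt ->
    (forall g h, g != h -> lt g h || lt h g) ->
    word_on X w -> reduced w -> has (fun a => a.1 == x) w ->
  exists l1 a l2, [/\ w = l1 ++ a :: l2, a.1 = x &
    forall k1 b k2, w = k1 ++ b :: k2 -> b.1 = x -> size k1 != size l1 ->
      lt (letter_base k1 b) (letter_base l1 a)].
Proof.
move=> ltxx lt_trans lt_total Xw rw hx.
pose d := (x, true); pose base i := letter_base (take i w) (nth d w i).
pose s := [seq i <- iota 0 (size w) | (nth d w i).1 == x].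
have splitw i : (i < size w)%N -> w = take i w ++ nth d w i :: drop i.+1 w.
  by move=> iw; rewrite -drop_nth // cat_take_drop.
have [|||i] := @exists_minimal _ (fun i j => lt (base j) (base i)) s.
- by move=> i; exact: ltxx.
- by move=> j i k ij jk; exact: lt_trans jk ij.
- have [a aw ax] := hasP hx; rewrite -has_filter; apply/hasP.
  exists (index a w); first by rewrite mem_iota index_mem.
  by rewrite nth_index.
rewrite mem_filter mem_iota /= add0n => /andP[/eqP ix iw] imin.
exists (take i w), (nth d w i), (drop i.+1 w); split=> //; first exact: splitw.
move=> k1 b k2 ew bx; rewrite size_takel ?(ltnW iw) // => ki.
have kw : (size k1 < size w)%N by rewrite ew size_cat /= addnS ltnS leq_addr.
have ek : nth d w (size k1) = b by rewrite ew nth_cat ltnn subnn.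
have eb : base (size k1) = letter_base k1 b by rewrite /base ek {1}ew take_size_cat.
have : ~~ lt (base i) (base (size k1)).
  by apply: imin; rewrite mem_filter mem_iota ek bx eqxx.
rewrite eb => nlt; have [|h|h] := @orP _ _ (lt_total (letter_base k1 b) (base i) _).
- apply: contraNneq ki => e; apply/eqP; rewrite -[in RHS](size_takel (ltnW iw)).
  apply: (@letter_base_inj k1 b k2 _ (nth d w i) (drop i.+1 w)); rewrite -?ew //.
    exact: splitw.
  by rewrite bx ix.
- by [].
- by rewrite h in nlt.
Qed.

End LetterPosition.

(** * Paths that enter or leave a component with a lift *)

Section Traces.
Variables (F : groupType) (V : choiceType) (act : V -> F -> V).
Hypotheses (act1 : forall v, act v 1 = v)
  (actM : forall v g h, act (act v g) h = act v (g * h)).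
Implicit Types (a b : F * bool) (w l k : seq (F * bool)) (v s : V).
Local Notation tip := (tip act).
Local Notation trace := (trace act).
Local Notation letter_edge := (letter_edge act).

Lemma trace_invariant (P : V -> Prop) v w :
    (forall e, e \in trace v w -> P e.1 <-> P (tip e)) -> P v ->
  P (act v (word_val w)) /\ forall e, e \in trace v w -> P e.1 /\ P (tip e).
Proof.
elim: w v => [|a w IH] v /= inv Pv; first by rewrite word_val_nil act1.
have [Pe Pt] : P (letter_edge v a).1 /\ P (tip (letter_edge v a)).
  have := inv _ (mem_head _ _).
  by case: (letter_edge_ends act1 actM v a) => -[-> ->] ?; tauto.
have Pa : P (act v (letter_val a)).
  by case: (letter_edge_ends act1 actM v a) Pe Pt => -[-> ->].
have [|P1 P2] := IH _ _ Pa; first by move=> e ew; apply: inv; rewrite inE ew orbT.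
rewrite word_val_cons -actM; split=> // e.
by rewrite inE => /orP[/eqP->|/P2].
Qed.

Lemma trace_label v w e : e \in trace v w -> exists2 a, a \in w & e.2 = a.1.
Proof.
elim: w v => //= a w IH v; rewrite inE => /orP[/eqP->|/IH[b bw ->]].
  by exists a; [exact: mem_head|rewrite /letter_edge; case: a.2].
by exists b; rewrite // inE bw orbT.
Qed.

Lemma letter_edgeE v a : letter_edge v a = (act v (letter_shift a), a.1).
Proof. by rewrite /letter_edge /letter_shift; case: a.2; rewrite ?act1. Qed.

Lemma trace_split v l1 a l2 :
  letter_edge (act v (word_val l1)) a \in trace v (l1 ++ a :: l2).
Proof. by rewrite (trace_cat act1 actM) mem_cat mem_head orbT. Qed.

Section Crossing.
Variables (E : {fset V * F}) (M : pred (V * F)) (C : {fset V}) (lift : V -> F).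
Hypothesis closed_C : forall e, e \in E -> ~~ M e -> e.1 \in C \/ tip e \in C ->
  [/\ e.1 \in C, tip e \in C & lift (tip e) = lift e.1 * e.2].

Lemma lift_letter v a : letter_edge v a \in E -> ~~ M (letter_edge v a) ->
    v \in C \/ act v (letter_val a) \in C ->
  [/\ v \in C, act v (letter_val a) \in C
    & lift (act v (letter_val a)) = lift v * letter_val a].
Proof.
case: a => x [] eE nM vC; have := closed_C eE nM.
  by rewrite /tip /letter_val; apply.
rewrite /tip /letter_edge /letter_val /= (actVK act1 actM) in vC *.
by case=> [|-> -> ->]; [tauto|split=> //; rewrite mulgK].
Qed.

(** Up to its first edge in [M] the path stays in [C] and the lift follows it. That edge need not
    itself leave [C]. *)
Lemma first_crossing s l : {subset trace s l <= E} -> s \in C ->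
    act s (word_val l) \notin C ->
  exists k1 b k2, [/\ l = k1 ++ b :: k2, M (letter_edge (act s (word_val k1)) b),
    act s (word_val k1) \in C & lift (act s (word_val k1)) = lift s * word_val k1].
Proof.
elim: l s => [|a l IH] s /= sub sC; first by rewrite word_val_nil act1 sC.
rewrite word_val_cons -actM => nC.
have [Me|nM] := boolP (M (letter_edge s a)).
  by exists [::], a, l; rewrite word_val_nil mulg1 act1.
have aE : letter_edge s a \in E by rewrite sub ?mem_head.
have [|_ aC la] := lift_letter aE nM; first by left.
have [|k1 [b [k2 [-> Mb kC lk]]]] := IH _ _ aC nC.
  by move=> e el; apply: sub; rewrite inE el orbT.
exists (a :: k1), b, k2; rewrite word_val_cons -actM; split=> //.
by rewrite lk la mulgA.
Qed.

(** The mirror image of [first_crossing], read from the end of the path. *)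
Lemma last_crossing v l : {subset trace v l <= E} -> v \notin C ->
    act v (word_val l) \in C ->
  exists k1 b k2, [/\ l = k1 ++ b :: k2, M (letter_edge (act v (word_val k1)) b),
    act v (word_val (rcons k1 b)) \in C
    & lift (act v (word_val l)) = lift (act v (word_val (rcons k1 b))) * word_val k2].
Proof.
elim/last_ind: l => [|l a IH] sub vC; first by rewrite word_val_nil act1 (negbTE vC).
move=> aC; have [Me|nM] := boolP (M (letter_edge (act v (word_val l)) a)).
  by exists l, a, [::]; rewrite cats1 word_val_nil mulg1.
rewrite word_val_rcons -actM in aC *.
have aE : letter_edge (act v (word_val l)) a \in E.
  by apply: sub; rewrite -cats1 trace_split.
have [|lC _ la] := lift_letter aE nM; first by right.
have [|k1 [b [k2 [el Mb kC lk]]]] := IH _ vC lC.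
  move=> e el; apply: sub; rewrite -cats1 (trace_cat act1 actM) mem_cat el //.
exists k1, b, (rcons k2 a); rewrite {1}el rcons_cat; split=> //.
by rewrite la lk (word_val_rcons k2) mulgA.
Qed.

End Crossing.
End Traces.

(** * The bound for finitely many basis elements *)

Section RankBound.
Variables (F : groupType) (V : choiceType) (act : V -> F -> V).
Hypotheses (act1 : forall v, act v 1 = v)
  (actM : forall v g h, act (act v g) h = act v (g * h)).
Variables (v0 : V) (X H K A : set F) (B A' : {fset F}) (x : F) (w : seq (F * bool)).
Hypotheses (bX : free_basis setT X) (Xw : word_on X w) (rw : reduced w).
(** If [w] has no letter [x], it is already a word in [rest] and offers no edge to mark; its value
    is then not added to [gens]. *)
Let with_x : bool := has (fun a => a.1 == x) w.
Let rest : set F := [set y | X y /\ y <> x].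
Let gens : set F := [set y | rest y \/ y = word_val w /\ with_x].
Hypotheses (sH : is_subgroup H) (restH : rest `<=` H) (Hw : H (word_val w))
  (KE : forall g, K g <-> H g /\ act v0 g = v0) (bA : free_basis K A)
  (AA' : [set` A'] `<=` A)
  (A'gen : forall a, a \in A' -> exists2 u, word_on gens u & word_val u = a)
  (Bgen : forall g, act v0 g = v0 -> exists2 u, word_on [set` B] u & word_val u = g)
  (Bstab : forall b, b \in B -> act v0 b = v0).
Local Notation tip := (tip act).
Local Notation trace := (trace act).
Local Notation letter_edge := (letter_edge act).

Let path a : seq (F * bool) := xget [::] [set u | word_on gens u /\ word_val u = a].

Let pathP a : a \in A' -> word_on gens (path a) /\ word_val (path a) = a.
Proof.
by move=> /A'gen[u ug ua]; apply: (@xgetPex _ [::] [set u | word_on gens u /\ _]); exists u.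
Qed.

(* Edges of the coset graph of H, labelled by [gens], used by the loops in A'. *)
Let EH : seq (V * F) := flatten [seq trace v0 (path a) | a <- A'].
Let W : {fset V} := [fset e.1 | e in EH & with_x && (e.2 == word_val w)]%fset.
(** The finite graph to which [euler_upper] is applied. *)
Let E : {fset V * F} :=
  [fset e in [seq e <- EH | `[< rest e.2 >]] ++ flatten [seq trace v w | v <- W]]%fset.
Let S : {fset V} := (v0 |` ([fset e.1 | e in E] `|` [fset tip e | e in E]))%fset.
(** The graph behind [euler_lower]. It also takes in the edges of the [w]-paths not labelled [x], so
    that it can be compared with [E] edge by edge. *)
Let EHS : {fset V * F} :=
  ([fset e in E | e.2 != x] `|` [fset (v, word_val w) | v in W])%fset.
(* The component of v0 in EHS, cut out by the functions constant on components. *)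
Let SH : {fset V} := [fset s in S | `[< forall p : V -> bool,
  (forall e, e \in EHS -> p e.1 = p (tip e)) -> p s = p v0 >]]%fset.

Let memE e : (e \in E) = (e \in [seq e <- EH | `[< rest e.2 >]])
  || (e \in flatten [seq trace v w | v <- W]).
Proof. by rewrite /E in_fset -mem_cat. Qed.

Let memEHS e :
  (e \in EHS) = (e \in E) && (e.2 != x) || (e \in [fset (v, word_val w) | v in W]%fset).
Proof. by rewrite /EHS in_fsetU !inE. Qed.

Let memS s : (s \in S) = [|| s == v0, s \in [fset e.1 | e in E]%fset
  | s \in [fset tip e | e in E]%fset].
Proof. by rewrite /S in_fset1U in_fsetU. Qed.

Let EH_gens e : e \in EH -> gens e.2.
Proof.
case/flatten_mapP => a aA' /trace_label[b bw ->].
by have [/(_ b bw)] := pathP aA'.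
Qed.

Let EH_cases e : e \in EH ->
  (e \in E /\ rest e.2) \/ [/\ with_x, e.2 = word_val w & e.1 \in W].
Proof.
move=> eEH; have [r|[ew hx]] := EH_gens eEH.
  left; split=> //; rewrite memE mem_filter eEH andbT.
  by apply/orP; left; apply/asboolP.
right; split=> //; apply/imfsetP; exists e => //=.
by rewrite inE eEH hx ew eqxx.
Qed.

Let W_trace v : v \in W -> {subset trace v w <= E}.
Proof.
move=> vW e ev; rewrite memE; apply/orP; right.
by apply/flatten_mapP; exists v.
Qed.

Let W_EH v : v \in W -> with_x /\ exists2 e, e \in EH & e.1 = v /\ e.2 = word_val w.
Proof.
case/imfsetP => e; rewrite !inE /= => /and3P[eEH hx /eqP ew] ->.
by split=> //; exists e.
Qed.

Let E_cases e : e \in E -> (e \in EH /\ rest e.2) \/ exists2 v, v \in W & e \in trace v w.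
Proof.
rewrite memE mem_filter => /orP[/andP[/asboolP r eEH]|]; first by left.
by case/flatten_mapP => v vW ev; right; exists v.
Qed.

Let E_label e : e \in E -> X e.2.
Proof.
case/E_cases => [[_ []]|[v _ /trace_label[a /Xw Xa ->]]] //.
Qed.

Let E_ends e : e \in E -> e.1 \in S /\ tip e \in S.
Proof.
move=> eE; rewrite !memS; split; apply/orP; right; apply/orP; [left|right].
  by apply/imfsetP; exists e.
by apply/imfsetP; exists e.
Qed.

Let Sv0 : v0 \in S. Proof. by rewrite memS eqxx. Qed.

Let EH_invariant (P : V -> Prop) :
  (forall e, e \in EH -> P e.1 <-> P (tip e)) -> P v0 ->
  forall e, e \in EH -> P e.1 /\ P (tip e).
Proof.
move=> inv P0 e /flatten_mapP[a aA' ea].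
have [|_] := @trace_invariant _ _ _ act1 actM P v0 (path a) _ P0; last exact.
by move=> e' e'a; apply: inv; apply/flatten_mapP; exists a.
Qed.

Let W_invariant (P : V -> Prop) v : v \in W ->
  (forall e, e \in E -> P e.1 <-> P (tip e)) -> P v <-> P (act v (word_val w)).
Proof.
move=> vW inv; have inv' e : e \in trace v w -> P e.1 <-> P (tip e).
  by move=> /(W_trace vW); exact: inv.
split; first by move=> Pv; have [] := trace_invariant act1 actM inv' Pv.
move=> Pv; have [//|nP] := pselect (P v).
have [|//] := @trace_invariant _ _ _ act1 actM (fun v => ~ P v) v w _ nP.
by move=> e /inv' h; tauto.
Qed.

Let E_invariant (P : V -> Prop) :
  (forall e, e \in E -> P e.1 <-> P (tip e)) -> P v0 -> forall s, s \in S -> P s.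
Proof.
move=> inv P0; have PEH : forall e, e \in EH -> P e.1 /\ P (tip e).
  apply: EH_invariant P0 => e /EH_cases[[eE _]|[_ ew eW]]; first exact: inv.
  by rewrite /tip ew; exact: W_invariant.
have PE e : e \in E -> P e.1 /\ P (tip e).
  case/E_cases => [[/PEH//]|[v vW ev]].
  have [_ [e' /PEH[Pv _] [e'v _]]] := W_EH vW; rewrite e'v in Pv.
  have [|_] := @trace_invariant _ _ _ act1 actM P v w _ Pv; last exact.
  by move=> e1 /(W_trace vW); exact: inv.
move=> s; rewrite memS => /or3P[/eqP->//|/imfsetP[e /= /PE[Pe _] ->//]|].
by case/imfsetP => e /= /PE[_ Pe] ->.
Qed.

Let S_orbit s : s \in S -> exists g, act v0 g = s.
Proof.
apply: (@E_invariant (fun s => exists g, act v0 g = s)) => [e _|]; last by exists 1.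
split=> -[g gs]; first by exists (g * e.2); rewrite -actM gs.
by exists (g * e.2^-1); rewrite -actM gs /tip (actK act1 actM).
Qed.

Let EH_EHS e : e \in EH -> e \in EHS.
Proof.
case/EH_cases => [[eE [_ /eqP nx]]|[_ ew eW]]; rewrite memEHS; apply/orP.
  by left; apply/andP.
by right; apply/imfsetP; exists e.1; rewrite // -ew; case: (e).
Qed.

Let EH_S e : e \in EH -> e.1 \in S /\ tip e \in S.
Proof.
apply: (@EH_invariant (fun s => s \in S)) => // {}e /EH_cases[[/E_ends[-> ->]]|] //.
move=> [_ ew eW]; rewrite /tip ew; apply: (@W_invariant (fun s => s \in S) _ eW) => e'.
by case/E_ends => -> ->.
Qed.

Let EHS_S e : e \in EHS -> e.1 \in S /\ tip e \in S.
Proof.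
rewrite memEHS => /orP[/andP[/E_ends//]|/imfsetP[v /= vW ->]].
have [_ [e' /EH_S[]]] := W_EH vW; rewrite /tip /= => e1 e2 [e'v e'w].
by rewrite -e'v -e'w.
Qed.

Let SHP s : reflect (s \in S /\ forall p : V -> bool,
    (forall e, e \in EHS -> p e.1 = p (tip e)) -> p s = p v0) (s \in SH).
Proof.
apply: (iffP idP); first by rewrite !inE => /andP[-> /asboolP].
by move=> [sS h]; rewrite inE /= inE sS; apply/asboolP.
Qed.

Let SHv0 : v0 \in SH. Proof. by apply/SHP. Qed.

Let EHS_SH e : e \in EHS -> (e.1 \in SH) = (tip e \in SH).
Proof.
move=> eE; have [e1 e2] := EHS_S eE.
apply/SHP/SHP => -[_ h]; split=> // p inv; have := h p inv; by rewrite inv.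
Qed.

Let W_SH v : v \in W -> v \in SH /\ act v (word_val w) \in SH.
Proof.
move=> vW; have [_ [e eEH [ev ew]]] := W_EH vW.
have [|] := @EH_invariant (fun s => s \in SH) _ SHv0 e eEH.
  by move=> e' /EH_EHS/EHS_SH->.
by rewrite /tip ev ew.
Qed.

Let EHF : {fset V * F} := [fset e in EHS | e.1 \in SH]%fset.

Let lower : (#|` A'| + #|` SH| <= #|` EHF| + 1)%N.
Proof.
have inEHF e : (e \in EHF) = (e \in EHS) && (e.1 \in SH) by rewrite inE.
have EHS_H e : e \in EHS -> H e.2.
  rewrite memEHS => /orP[/andP[eE nx]|/imfsetP[v _ ->]] //.
  by apply: restH; split; [exact: E_label|exact/eqP].
apply: (euler_lower act1 actM bA sH KE AA' SHv0).
- move=> s /SHP[_ /(_ (fun s => `[< exists2 h, H h & act v0 h = s >]))] h.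
  have H1 : H 1 by apply/set_mem; case: sH.
  have : `[< exists2 h, H h & act v0 h = v0 >] by apply/asboolP; exists 1.
  rewrite -h; first by move/asboolP.
  move=> e /EHS_H He; have /set_mem HV := group_closedV sH (mem_set He).
  apply/asboolP/asboolP => -[g Hg gs].
    exists (g * e.2); last by rewrite -actM gs.
    by apply/set_mem/(group_closedM sH); exact/mem_set.
  exists (g * e.2^-1); last by rewrite -actM gs /tip (actK act1 actM).
  by apply/set_mem/(group_closedM sH); exact/mem_set.
- move=> e; rewrite inEHF => /andP[eE e1]; split=> //; first exact: EHS_H.
  by rewrite -EHS_SH.
- move=> p inv s sSH; have [_ /(_ (fun s => (s \in SH) && (p s == p v0)))] := SHP _ sSH.
  rewrite sSH SHv0 eqxx /= => h; apply/eqP; rewrite h // => e eE.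
  rewrite -EHS_SH //; case: (boolP (e.1 \in SH)) => //= e1.
  by rewrite inv // inEHF eE.
- move=> a aA'; have [pg pa] := pathP aA'; exists (path a) => // e ea.
  have eEH : e \in EH by apply/flatten_mapP; exists a.
  rewrite inEHF (EH_EHS eEH) /=.
  have [|//] := @EH_invariant (fun s => s \in SH) _ SHv0 e eEH.
  by move=> e' /EH_EHS/EHS_SH->.
Qed.

Let upper : (#|` E| + 1 <= #|` B| + #|` S|)%N.
Proof.
apply: (euler_upper act1 actM Sv0 bX Bgen Bstab S_orbit) => e eE.
by have [? ?] := E_ends eE; split=> //; exact: E_label.
Qed.

(** The edges common to both counts: besides them [EHF] has at most one edge for each vertex of
    [W]. *)
Let ER : {fset V * F} := [fset e in E | (e.2 != x) && (e.1 \in SH)]%fset.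

Let memER e : (e \in ER) = [&& e \in E, e.2 != x & e.1 \in SH].
Proof. by rewrite /ER !inE. Qed.

Let EHF_card : (#|` EHF| <= #|` ER| + #|` W|)%N.
Proof.
have sub : (EHF `<=` ER `|` [fset (v, word_val w) | v in W])%fset.
  apply/fsubsetP => e; rewrite !inE => /andP[/orP[/andP[-> ->] ->//|eW] _].
  by rewrite eW orbT.
apply: leq_trans (fsubset_leq_card sub) _.
apply: (@leq_trans (#|` ER| + #|` [fset (v, word_val w) | v in W]%fset|)).
  by rewrite -cardfsUI leq_addr.
by rewrite leq_add2l; exact: leq_imfset_card.
Qed.

(** By [lower], [upper] and [EHF_card] it is enough that the vertices outside [SH], collected in
    [Z], be at most as many as the edges in [Q], which are neither in [ER] nor marked. *)
Lemma rank_bound : (#|` A'| <= #|` B|)%N.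
Proof.
have [lt [ltxx lt_trans lt_total lt_inv]] := free_left_order bX.
(* [u] is the position of the largest [x]-edge relative to the start of a [w]-path; the default 1
   serves when [w] has no [x], and then [W] is empty. *)
have [u topu] : exists u, with_x -> exists l1 a l2, [/\ w = l1 ++ a :: l2, a.1 = x,
    u = letter_base l1 a & forall k1 b k2, w = k1 ++ b :: k2 -> b.1 = x ->
      size k1 != size l1 -> lt (letter_base k1 b) u].
  have [hx|_] := boolP with_x; last by exists 1.
  have [l1 [a [l2 [ew ax top]]]] := exists_top_letter bX ltxx lt_trans lt_total Xw rw hx.
  by exists (letter_base l1 a) => _; exists l1, a, l2.
pose M : {fset V * F} := [fset (act v u, x) | v in W]%fset.
(* The action of [u] is injective on vertices, so different [w]-paths have different marked
   edges. *)
have cardM : #|` M| = #|` W|.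
  by rewrite card_imfset // => v v' [] /(can_inj (actK act1 actM u)).
have MP e : e \in M -> exists l1 a l2 v, [/\ v \in W, w = l1 ++ a :: l2,
    e = letter_edge (act v (word_val l1)) a, u = letter_base l1 a & forall k1 b k2,
    w = k1 ++ b :: k2 -> b.1 = x -> size k1 != size l1 -> lt (letter_base k1 b) u].
  case/imfsetP => v /= vW ->; have [hx _] := W_EH vW.
  have [l1 [a [l2 [ew ax eu top]]]] := topu hx; exists l1, a, l2, v; split=> //.
  by rewrite (letter_edgeE act1) actM ax eu.
have ME : (M `<=` E)%fset.
  apply/fsubsetP => e /MP[l1 [a [l2 [v [vW ew -> _ _]]]]].
  by apply: (W_trace vW); rewrite ew; exact: trace_split.
have Mx e : e \in M -> e.2 = x by case/imfsetP => v _ ->.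
pose Q := (E `\` (ER `|` M))%fset; pose Z := (S `\` SH)%fset.
have cardQ : #|` E| = (#|` Q| + (#|` ER| + #|` W|))%N.
  have sub : (ER `|` M `<=` E)%fset.
    rewrite fsubUset ME andbT; apply/fsubsetP => e; rewrite memER.
    by case/andP.
  have disj : [disjoint ER & M]%fset.
    apply/fdisjointP => e; rewrite memER => /and3P[_ /eqP nx _].
    by apply/negP => /Mx.
  have := cardfsUI ER M; have := cardfsDS sub; have := fsubset_leq_card sub.
  by rewrite (eqP disj) cardfs0 -/Q; lia.
have cardZ : #|` S| = (#|` Z| + #|` SH|)%N.
  have sub : (SH `<=` S)%fset by apply/fsubsetP => s /SHP[].
  by have := cardfsDS sub; have := fsubset_leq_card sub; rewrite -/Z; lia.
have [leZQ|ltQZ] := leqP #|` Z| #|` Q|.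
  by have := lower; have := upper; have := EHF_card; lia.
have [C [lift [C0 CZ Ccl]]] := tree_component act ltQZ.
have CSH s : s \in C -> s \notin SH.
  by move/(fsubsetP CZ); rewrite inE => /andP[].
(* An unmarked edge that meets [C] lies in [Q], because edges of [ER] have both ends in [SH]. *)
have closed_C e : e \in E -> ~~ (e \in M) -> e.1 \in C \/ tip e \in C ->
    [/\ e.1 \in C, tip e \in C & lift (tip e) = lift e.1 * e.2].
  move=> eE nM eC; apply: Ccl => //; rewrite in_fsetD in_fsetU (negbTE nM) orbF eE andbT memER.
  apply/negP => /and3P[_ nx e1].
  have e2 : tip e \in SH by rewrite -EHS_SH // memEHS eE nx.
  by case: eC => /CSH; rewrite ?e1 ?e2.
(* The lifted positions of the marked edges that touch [C]; an edge with both ends in [C] may have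
   two. *)
pose I := [seq lift e.1 | e <- M & e.1 \in C] ++
          [seq lift (tip e) * x^-1 | e <- M & tip e \in C].
(* Otherwise no edge of [E] leaves [C], although [E] is connected and [v0] lies outside [C]. *)
have I0 : I != [::].
  apply/eqP => I0; have nM e : e \in M -> e.1 \notin C /\ tip e \notin C.
    move=> eM; split; apply/negP => eC.
      suff : lift e.1 \in I by rewrite I0.
      by rewrite mem_cat; apply/orP; left; apply: map_f; rewrite mem_filter eC.
    suff : lift (tip e) * x^-1 \in I by rewrite I0.
    rewrite mem_cat; apply/orP; right.
    by apply: (map_f (fun e => lift (tip e) * x^-1)); rewrite mem_filter eC.
  have [s sC] := fset0Pn _ C0.
  have sS : s \in S by move/(fsubsetP CZ): sC; rewrite inE => /andP[].
  suff : s \notin C by rewrite sC.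
  apply: (@E_invariant (fun s => s \notin C)) sS => [e eE|].
    have [eM|eM] := boolP (e \in M).
      by have [-> ->] := nM e eM.
    have h := closed_C e eE eM.
    by split; apply: contra => eC; have [] // := h; [right|left].
  by apply/negP => /CSH; rewrite SHv0.
have IP v b : letter_edge v b \in M ->
    (v \in C -> lift v * letter_shift b \in I) /\
    (act v (letter_val b) \in C ->
       lift (act v (letter_val b)) * (letter_val b)^-1 * letter_shift b \in I).
  move=> eM; have bx : b.1 = x by rewrite -(Mx _ eM) (letter_edgeE act1).
  move: eM; rewrite /letter_edge /letter_shift /letter_val bx.
  case: b.2 => eM; rewrite ?mulg1 ?invgK ?mulgK; split=> vC.
  - rewrite mem_cat; apply/orP; left; apply/mapP; exists (v, x) => //.
    by rewrite mem_filter eM vC.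
  - rewrite mem_cat; apply/orP; right; apply/mapP; exists (v, x) => //.
    by rewrite mem_filter eM vC.
  - rewrite mem_cat; apply/orP; right; apply/mapP; exists (act v x^-1, x).
      by rewrite mem_filter eM /tip (actVK act1 actM) vC.
    by rewrite /tip (actVK act1 actM).
  - rewrite mem_cat; apply/orP; left; apply/mapP; exists (act v x^-1, x) => //.
    by rewrite mem_filter eM vC.
have [m mI mmin] := exists_minimal ltxx lt_trans I0.
exfalso; have [e [eM me]] : exists e, e \in M /\
    (e.1 \in C /\ m = lift e.1 \/ tip e \in C /\ m = lift (tip e) * x^-1).
  move: mI; rewrite mem_cat => /orP[] /mapP[e]; rewrite mem_filter => /andP[eC eM] ->.
    by exists e; split=> //; left.
  by exists e; split=> //; right.
have [l1 [a [l2 [v [vW ew ee eu top]]]]] := MP e eM.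
(* By left invariance, any other [x]-edge on the same lifted [w]-path lies strictly below the marked
   one, so its presence in [I] contradicts the minimality of [m]. *)
have smaller g k1 b k2 : w = k1 ++ b :: k2 -> b.1 = x -> size k1 != size l1 ->
    g * letter_base k1 b \in I -> m = g * u -> False.
  by move=> ek bx nk /mmin nlt mg; case/negP: nlt; rewrite mg lt_inv; exact: top ek bx nk.
have Mlabel s b : letter_edge s b \in M -> b.1 = x.
  by move/Mx; rewrite (letter_edgeE act1).
have ax : a.1 = x by apply: (@Mlabel (act v (word_val l1))); rewrite -ee.
have [vSH wSH] := W_SH vW.
have sub := W_trace vW; rewrite ew (trace_cat act1 actM) in sub.
pose s1 := act v (word_val l1); pose s2 := act s1 (letter_val a).
(* Since v and its image under w lie outside C, the w-path through the minimal
   marked edge enters or leaves C through a second, smaller marked edge. *)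
have [[s1C ms]|[s2C ms]] :
    s1 \in C /\ m = lift s1 * (word_val l1)^-1 * u \/
    s2 \in C /\ m = lift s2 * (word_val l1 * letter_val a)^-1 * u.
- move: me; rewrite ee eu /s2 /s1 /letter_base /letter_shift /letter_edge /tip /letter_val.
  rewrite ax !mulgA; case: a.2 => /=; rewrite ?mulg1 ?(actVK act1 actM) ?mulgVK ?invgM;
    rewrite ?mulgA ?mulgVK => -[[eC ->]|[eC ->]]; by [left|right].
- have [||k1 [b [k2 [el bM kC lk]]]] := last_crossing act1 actM closed_C _ _ s1C.
  + by move=> e' e'l; apply: sub; rewrite mem_cat e'l.
  + by apply/negP => /CSH; rewrite vSH.
  + apply: (smaller (lift s1 * (word_val l1)^-1) k1 b (k2 ++ a :: l2)) => //.
    * by rewrite ew el -catA.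
    * exact: Mlabel bM.
    * by rewrite el size_cat neq_ltn -{1}[size k1]addn0 ltn_add2l.
    * have [_] := IP _ _ bM; rewrite actM -word_val_rcons => /(_ kC).
      rewrite /s1 lk el /letter_base word_val_cat word_val_cons !invgM !mulgA.
      by rewrite mulgK mulgVK.
- have [||k1 [b [k2 [el bM kC lk]]]] := first_crossing act1 actM closed_C _ s2C (l := l2).
  + by move=> e' e'l; apply: sub; rewrite mem_cat inE e'l !orbT.
  + rewrite /s2 /s1 !actM -word_val_cons -word_val_cat -ew.
    by apply/negP => /CSH; rewrite wSH.
  + apply: (smaller (lift s2 * (word_val l1 * letter_val a)^-1) (l1 ++ a :: k1) b k2) => //.
    * by rewrite ew el -catA.
    * exact: Mlabel bM.
    * by rewrite size_cat neq_ltn orbC -{1}[size l1]addn0 ltn_add2l.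
    * have [/(_ kC) + _] := IP _ _ bM.
      rewrite lk /letter_base word_val_cat word_val_cons !invgM !mulgA.
      by rewrite mulgVK mulgVK.
Qed.

End RankBound.

(** * Cardinal arithmetic *)

Section Cardinals.

Definition embeds (T U : Type) (A : set T) (B : set U) : Prop :=
  exists f : T -> U, (forall a, A a -> B (f a)) /\
    forall a b, A a -> A b -> f a = f b -> a = b.

(** Maps are kept as graphs, so that the union of a chain is again of the same kind. *)
Definition partial_bijection (T U : Type) (R : set (T * U)) : Prop :=
  forall p q, R p -> R q -> p.1 = q.1 <-> p.2 = q.2.

Lemma chain_bigcup2 (T : Type) (C : set (set T)) p q : total_on C subset ->
  (\bigcup_(R in C) R) p -> (\bigcup_(R in C) R) q -> exists R, [/\ C R, R p & R q].
Proof.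
move=> Ctot [R CR Rp] [R' CR' Rq].
have [RR'|R'R] := Ctot R R' CR CR'; first by exists R'; split=> //; exact: RR'.
by exists R; split=> //; exact: R'R.
Qed.

Lemma partial_bijection_embeds (T U : choiceType) (u0 : U) (R : set (T * U)) A B :
  partial_bijection R -> (forall a, A a -> exists2 b, R (a, b) & B b) -> embeds A B.
Proof.
move=> Rinj Rdom; exists (fun a => xget u0 [set b | R (a, b) /\ B b]).
have fP a : A a -> [set b | R (a, b) /\ B b] (xget u0 [set b | R (a, b) /\ B b]).
  by move=> /Rdom[b Rab Bb]; apply: xgetPex; exists b.
split=> [a /fP[]//|a a' /fP[Ra _] /fP[Ra' _] e].
exact: (Rinj _ _ Ra Ra').2 e.
Qed.

Lemma partial_bijectionV (T U : Type) (R : set (T * U)) :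
  partial_bijection R -> partial_bijection [set p | R (p.2, p.1)].
Proof. by move=> Rinj p q Rp Rq; have [] := Rinj _ _ Rp Rq. Qed.

(** A maximal partial bijection exhausts [A] or [B]; otherwise one more pair could be added. *)
Lemma embeds_total (T U : choiceType) (t0 : T) (u0 : U) (A : set T) (B : set U) :
  embeds A B \/ embeds B A.
Proof.
pose P (R : set (T * U)) := partial_bijection R /\ R `<=` A `*` B.
have [C CP Ctot|M [[Minj MAB] Mmax]] := @Zorn_bigcup _ P.
  split=> [p q Cp Cq|p [R /CP[_ RAB] /RAB]] //.
  by have [R [/CP[Rinj _] Rp Rq]] := chain_bigcup2 Ctot Cp Cq; exact: Rinj.
have [Mdom|/existsNP[a /not_implyP[Aa nMa]]] :=
    pselect (forall a, A a -> exists b, M (a, b)).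
  left; apply: (partial_bijection_embeds u0 Minj) => a /Mdom[b Mab].
  by exists b => //; have [] := MAB _ Mab.
right; apply: (partial_bijection_embeds t0 (partial_bijectionV Minj)) => b Bb.
have [[a' Ma'b]|nMb] := pselect (exists a', M (a', b)).
  by exists a' => //; have [] := MAB _ Ma'b.
exfalso; apply: (Mmax (M `|` [set (a, b)])); first split.
- by move=> p; left.
- by move=> /(_ (a, b) (or_intror erefl)) Mab; apply: nMa; exists b.
split; last by move=> p [/MAB//|->].
move=> [p1 p2] [q1 q2] [Mp|[-> ->]] [Mq|[-> ->]] //=.
- exact: Minj Mp Mq.
- split=> e; first by exfalso; apply: nMa; exists p2; rewrite -e.
  by exfalso; apply: nMb; exists p1; rewrite -e.
- split=> e; first by exfalso; apply: nMa; exists q2; rewrite e.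
  by exfalso; apply: nMb; exists q1; rewrite e.
Qed.

(** * An infinite set absorbs its square *)

Section Square.
Variables (T : choiceType) (D : set T) (e : nat -> T).
Hypotheses (eD : forall i, D (e i)) (e_inj : injective e).

Let diag (R : set (T * T * T)) : set T := [set t | exists u, R ((t, t), u)].

(** [R] is the graph of an injection of E x E into E for some subset E of [D], which is read off the
    diagonal. *)
Let square_like R := [/\ partial_bijection R,
  forall s t u, R ((s, t), u) -> [/\ diag R s, diag R t & diag R u],
  forall s t, diag R s -> diag R t -> exists u, R ((s, t), u) & diag R `<=` D].

Let base : set (T * T * T) := [set p | exists i j, p = ((e i, e j), e (choice.pickle (i, j)))].

Let base_diag i : diag base (e i).
Proof. by exists (e (choice.pickle (i, i))), i, i. Qed.

Let base_square : square_like base.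
Proof.
split.
- move=> _ _ [i [j ->]] [k [l ->]] /=; split=> [[/e_inj-> /e_inj->]//|].
  by move=> /e_inj /(pcan_inj choice.pickleK)[-> ->].
- by move=> _ _ _ [i [j [-> -> ->]]]; split; exact: base_diag.
- by move=> _ _ [_ [i [_ [-> _ _]]]] [_ [j [_ [-> _ _]]]]; exists (e (choice.pickle (i, j))), i, j.
- by move=> _ [_ [i [_ [-> _ _]]]]; exact: eD.
Qed.

Let chain_square (C : set (set (T * T * T))) :
  C `<=` square_like -> total_on C subset -> square_like (\bigcup_(R in C) R).
Proof.
move=> CP Ctot; have sub R : C R -> diag R `<=` diag (\bigcup_(R in C) R).
  by move=> CR t [u Ru]; exists u, R.
split.
- move=> p q Cp Cq; have [R [/CP[Rinj _ _ _] Rp Rq]] := chain_bigcup2 Ctot Cp Cq.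
  exact: Rinj.
- move=> s t u [R CR Rstu]; have [_ /(_ _ _ _ Rstu)[? ? ?] _ _] := CP _ CR.
  by split; apply: (sub R).
- move=> s t [u Cs] [v Ct]; have [R [CR Rs Rt]] := chain_bigcup2 Ctot Cs Ct.
  have [_ _ Rtot _] := CP _ CR.
  by have [w Rw] := Rtot s t (ex_intro _ u Rs) (ex_intro _ v Rt); exists w, R.
- by move=> t [u [R CR Rtu]]; have [_ _ _] := CP _ CR; apply; exists u.
Qed.

(** Take a maximal pairing on E. If E embeds in its complement, the pairing extends to two copies of
    E, a contradiction; otherwise the complement embeds in E, and so does [D]. *)
Lemma square_embeds : embeds (D `*` D) D.
Proof.
have [M [[Minj Mdom Mtot MD] baseM Mmax]] : exists M, [/\ square_like M, base `<=` M
    & forall M', M `<` M' -> ~ square_like M'].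
  (* Joining [base] to each relation covers the empty chain in Zorn's lemma and keeps E infinite. *)
  have [C CP Ctot|M [PM Mmax]] := @Zorn_bigcup _ (fun R => square_like (R `|` base)).
    have -> : \bigcup_(R in C) R `|` base =
        \bigcup_(R in [set base] `|` [set R `|` base | R in C]) R.
      apply/seteqP; split=> p.
        by case=> [[R CR Rp]|bp]; [exists (R `|` base); [right; exists R|left]
          |exists base; [left|]].
      by case=> _ [->|[R CR <-]]; [right|case=> [Rp|bp]; [left; exists R|right]].
    apply: chain_square => [_ [->//|[R CR <-]]|]; first exact: CP.
    move=> _ _ [->|[R CR <-]] [->|[R' CR' <-]].
    + by left.
    + by left; right.
    + by right; right.
    + by have [h|h] := Ctot _ _ CR CR'; [left|right]; apply: setSU.
  exists (M `|` base); split=> // M' MM' PM'.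
  have bM' : base `<=` M' by apply: subset_trans (properW MM'); exact: subsetUr.
  apply: (Mmax M'); last by rewrite setUidl.
  have [MM nMM] := MM'; split; first by apply: subset_trans MM; exact: subsetUl.
  by move=> M'M; apply: nMM; apply: subset_trans M'M _; exact: subsetUl.
pose E := diag M.
have Ee i : E (e i) by have [u bu] := base_diag i; exists u; exact: baseM.
have [f [fE f_inj]] : embeds (E `*` E) E.
  apply: (partial_bijection_embeds (e 0%N) Minj) => -[s t] [Es Et].
  by have [u Mu] := Mtot s t Es Et; exists u => //; have [] := Mdom _ _ _ Mu.
have f_injE s t s' t' : E s -> E t -> E s' -> E t' -> f (s, t) = f (s', t') ->
    s = s' /\ t = t'.
  by move=> Es Et Es' Et' /(f_inj (s, t) (s', t') (conj Es Et) (conj Es' Et'))[].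
have [[g [gE g_inj]]|[j [jE j_inj]]] :=
    embeds_total (e 0%N) (e 0%N) E (D `\` E).
  exfalso; pose E' := E `|` g @` E.
  pose r t := if `[< E t >] then t else xget (e 0%N) [set s | E s /\ g s = t].
  have rg s : E s -> r (g s) = s.
    move=> Es; rewrite /r asboolF; last by case: (gE _ Es).
    have [] := @xgetPex _ (e 0%N) [set s' | E s' /\ g s' = g s] (ex_intro _ s (conj Es erefl)).
    by move=> Er; exact: g_inj.
  have rE t : E t -> r t = t by move=> Et; rewrite /r asboolT.
  have Er t : E' t -> E (r t) by case=> [Et|[s Es <-]]; [rewrite rE|rewrite rg].
  have r_inj s t : E' s -> E' t -> `[< E s >] = `[< E t >] -> r s = r t -> s = t.
    move=> [Es|[s' Es' <-]] [Et|[t' Et' <-]]; rewrite ?(asboolT Es) ?(asboolT Et).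
    - by rewrite !rE.
    - by rewrite asboolF //; case: (gE _ Et').
    - by rewrite asboolF //; case: (gE _ Es').
    - by rewrite !rg // => _ ->.
  (* Two bits record which of [s] and [t] lie in E, as [r] forgets it. The values of [new] fall in
     the image of [g], off E, and so never meet old ones. *)
  pose k s t : nat := `[< E s >] + 2 * `[< E t >].
  pose new s t := g (f (e (k s t), f (r s, r t))).
  pose M' := M `|` [set p | exists s t,
    [/\ E' s, E' t, ~ (E s /\ E t) & p = ((s, t), new s t)]].
  have Enew s t : E' s -> E' t -> E (f (e (k s t), f (r s, r t))).
    by move=> Es Et; apply: (fE); split; [exact: Ee|apply: (fE); split; exact: Er].
  have diagM' t : diag M' t <-> E' t.
    split=> [[u [Mu|[_ [_ [Es _ _ [-> _ _]]]]]]|Et] //.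
      by left; exists u.
    have [Et'|nEt] := pselect (E t); first by have [u Mu] := Et'; exists u; left.
    by exists (new t t); right; exists t, t; split=> // -[].
  have M_E s t u : M ((s, t), u) -> [/\ E s, E t & E u] by exact: Mdom.
  apply: (Mmax M'); first split; first by move=> p; left.
    have [_ nE] := gE _ (Ee 0%N).
    move=> M'M; suff /M'M/M_E[] : M' ((g (e 0%N), g (e 0%N)), new (g (e 0%N)) (g (e 0%N))).
      by [].
    right; exists (g (e 0%N)), (g (e 0%N)); split; [| |by case|by []].
      by right; exists (e 0%N).
    by right; exists (e 0%N).
  split.
  - move=> [[p1 p2] p3] [[q1 q2] q3] [Mp|[s [t [Es Et nE [-> -> ->]]]]]
      [Mq|[s' [t' [Es' Et' nE' [-> -> ->]]]]] /=.
    + exact: Minj Mp Mq.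
    + have [Ep1 Ep2 Ep3] := M_E _ _ _ Mp; split=> [[e1 e2]|e3].
        by exfalso; apply: nE'; rewrite -e1 -e2.
      by have [_ []] := gE _ (Enew _ _ Es' Et'); rewrite -/(new _ _) -e3.
    + have [Ep1 Ep2 Ep3] := M_E _ _ _ Mq; split=> [[e1 e2]|e3].
        by exfalso; apply: nE; rewrite e1 e2.
      by have [_ []] := gE _ (Enew _ _ Es Et); rewrite -/(new _ _) e3.
    + split=> [[-> ->]//|]; rewrite /new => /(g_inj _ _ (Enew _ _ Es Et) (Enew _ _ Es' Et')).
      have Err a b : E' a -> E' b -> E (f (r a, r b)).
        by move=> Ea Eb; apply: (fE); split; exact: Er.
      case/f_injE; [exact: Ee|exact: Err|exact: Ee|exact: Err|].
      move=> /e_inj ek /f_injE[]; try exact: Er.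
      move: ek; rewrite /k => ek rs rt; have [es et] :
          `[< E s >] = `[< E s' >] /\ `[< E t >] = `[< E t' >].
        by move: ek; do 4 case: `[< _ >].
      by rewrite (r_inj _ _ Es Es' es rs) (r_inj _ _ Et Et' et rt).
  - move=> s t u [/M_E[Es Et Eu]|[s' [t' [Es Et _ [-> -> ->]]]]].
      by split; apply/diagM'; left.
    by split; apply/diagM' => //; right; exists (f (e (k s' t'), f (r s', r t'))) => //;
      exact: Enew.
  - move=> s t /diagM' Es /diagM' Et; have [[Es' Et']|nE] := pselect (E s /\ E t).
      by have [u Mu] := Mtot _ _ Es' Et'; exists u; left.
    by exists (new s t); right; exists s, t.
  - by move=> t /diagM'[/MD//|[s Es <-]]; have [] := gE _ Es.
(* The tags [e 0] and [e 1] keep the images of E and of its complement apart. *)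
pose h t := if `[< E t >] then f (e 0%N, t) else f (e 1%N, j t).
have hE t : D t -> E (h t).
  move=> Dt; rewrite /h; case: asboolP => Et; apply: (fE); split=> //=.
  by apply: jE.
have h_inj s t : D s -> D t -> h s = h t -> s = t.
  move=> Ds Dt; rewrite /h; case: asboolP => Es; case: asboolP => Et /f_injE[] //.
  - by apply: jE.
  - by move/e_inj.
  - by apply: jE.
  - by move/e_inj.
  - by apply: jE.
  - by apply: jE.
  - by move=> _; apply: j_inj.
exists (fun p => f (h p.1, h p.2)); split=> [[s t] [/hE Es /hE Et]|].
  by apply: MD; apply: (fE).
move=> [s t] [s' t'] [Ds Dt] [Ds' Dt'] /= /f_injE[]; try exact: hE.
by move=> /h_inj-> // /h_inj->.
Qed.

End Square.
End Cardinals.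

(** * Cosets, and words over an infinite basis *)

Section Cosets.
Variable F : groupType.
Implicit Types (v G : set F) (g h : F).

(** [F] acts on all its subsets; the orbit of a subgroup consists of its right cosets. *)
Definition translate v g : set F := [set z | v (z * g^-1)].

Lemma translate1 v : translate v 1 = v.
Proof. by apply/seteqP; split=> z; rewrite /translate /= invg1 mulg1. Qed.

Lemma translateM v g h : translate (translate v g) h = translate v (g * h).
Proof. by apply/seteqP; split=> z; rewrite /translate /= invgM mulgA. Qed.

Lemma translate_subgroup G g : is_subgroup G -> translate G g = G <-> G g.
Proof.
move=> sG; have G1 : G 1 by apply/set_mem; case: sG.
have GM a b : G a -> G b -> G (a * b).
  by move=> Ga Gb; apply/set_mem/(group_closedM sG); apply/mem_set.
have GV a : G a -> G a^-1.
  by move=> Ga; apply/set_mem/(group_closedV sG)/mem_set.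
split=> [<-|Gg]; first by rewrite /translate /= mulgV.
apply/seteqP; split=> z; rewrite /translate /= => Gz; last exact/GM/GV.
by rewrite -(mulgVK g z); apply: GM.
Qed.

Lemma embeds_card_le (A B : set F) : embeds A B -> A #<= B.
Proof.
move=> [f [fB f_inj]]; have : f @` A #= A.
  by apply: inj_card_eq => a b /set_mem Aa /set_mem Ab; exact: f_inj.
rewrite card_eq_le => /andP[_ Af]; apply: card_le_trans Af _.
by apply: subset_card_le => _ [a /fB ? <-].
Qed.

(** The length is coded beside the letters: nested pairs separate words of one length, but the final
    [e 0] could also be the code of a pair. *)
Lemma words_embed (B : set F) : infinite_set B ->
  embeds [set w : seq (F * bool) | word_on B w] B.
Proof.
move=> /infiniteP /card_leP[e0]; pose e i : F := val (e0 (SigSub (mem_setT i))).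
have eB i : B (e i) by exact: set_mem (valP (e0 _)).
have e_inj : injective e.
  by move=> i j /val_inj /(@inj _ _ _ e0 _ _ (mem_setT _) (mem_setT _)) [].
have [f [fB f_inj]] := square_embeds eB e_inj.
have f_injB s t s' t' : B s -> B t -> B s' -> B t' -> f (s, t) = f (s', t') ->
    s = s' /\ t = t'.
  by move=> Bs Bt Bs' Bt' /(f_inj (s, t) (s', t') (conj Bs Bt) (conj Bs' Bt'))[].
pose letter (a : F * bool) := f (a.1, e a.2).
have letterB a : B a.1 -> B (letter a) by move=> Ba; apply: (fB); split=> //=; exact: eB.
pose code := foldr (fun a c => f (letter a, c)) (e 0%N).
have codeB w : word_on B w -> B (code w).
  elim: w => [_|a w IH] /=; first exact: eB.
  by move=> /word_on_cons[/letterB Ba /IH Bw]; apply: (fB).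
have code_inj w w' : size w = size w' -> word_on B w -> word_on B w' ->
    code w = code w' -> w = w'.
  elim: w w' => [[]//|a w IH [//|a' w'] [sw]] /word_on_cons[Ba Bw] /word_on_cons[Ba' Bw'].
  case/f_injB; [exact: letterB|exact: codeB|exact: letterB|exact: codeB|].
  case/f_injB => // ea /e_inj eb /(IH _ sw Bw Bw') ->.
  by case: a a' ea eb {Ba Ba'} => x [] [x' []] /= -> .
exists (fun w => f (e (size w), code w)); split=> [w Bw|w w' Bw Bw'].
  by apply: (fB); split; [exact: eB|exact: codeB].
case/f_injB; [exact: eB|exact: codeB|exact: eB|exact: codeB|].
by move=> /e_inj sw; exact: code_inj.
Qed.

Lemma subgroup_embeds_basis (G B : set F) :
  free_basis G B -> infinite_set B -> embeds G B.
Proof.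
move=> bB /words_embed[c [cB c_inj]]; exists (fun g => c (reduced_word B g)).
split=> [g /(reduced_wordP bB)[Bg _ _]|g h Gg Gh]; first exact: cB.
have [Bg _ eg] := reduced_wordP bB Gg; have [Bh _ eh] := reduced_wordP bB Gh.
by move/(c_inj _ _ Bg Bh) => e; rewrite -eg -eh e.
Qed.

(** An infinite [A] would contain a finite set with more than |B| elements; a finite [A] can be
    taken as [A'] itself. *)
Lemma card_le_of_fsets (A : set F) (B : {fset F}) :
  (forall A' : {fset F}, [set` A'] `<=` A -> (#|` A'| <= #|` B|)%N) -> A #<= [set` B].
Proof.
move=> bound; have [finA|infA] := pselect (finite_set A); last first.
  have [C CA] := infinite_set_fset #|` B|.+1 infA.
  by have := bound C CA; lia.
have /finite_fsetP[C eA] := finA.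
have CB : (#|` C| <= #|` B|)%N by apply: bound; rewrite eA.
have cC : [set` C] #= `I_#|` C| by apply/card_eq_fsetP.
have cB : [set` B] #= `I_#|` B| by apply/card_eq_fsetP.
by rewrite eA (card_le_eql cC) (card_le_eqr cB) card_le_II.
Qed.

End Cosets.

Theorem theorem2p1 :
  forall (F : groupType) (phi : {multiplicative F -> F}),
    is_free F -> one_generator phi -> inert_endomorphism phi.
Proof.
move=> F phi _ [X [bX [x fix_phi]]].
have phi1 : phi 1 = 1 by apply: (@mulgI _ (phi 1)); rewrite -gmulfM !mulg1.
have phiV g : phi g^-1 = (phi g)^-1.
  by apply: (@mulgI _ (phi g)); rewrite -gmulfM !mulgV.
have sH : is_subgroup (range phi).
  split=> [|g h /set_mem[a _ <-] /set_mem[b _ <-]]; apply/mem_set.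
    by exists 1.
  by exists (a * b^-1); rewrite // gmulfM phiV.
split=> // G sG A B bA bB.
(* For infinite [B], the basis [A] lies in [G], which embeds in [B]. *)
have [finB|infB] := pselect (finite_set B); last first.
  apply: card_le_trans (embeds_card_le (subgroup_embeds_basis bB infB)).
  by apply: subset_card_le => a /bA.1[].
have /finite_fsetP[B' eB] := finB; rewrite eB; apply: card_le_of_fsets => A' A'A.
have [Xw rw ew] := reduced_wordP bX (I : [set: F] (phi x)).
set w := reduced_word X (phi x) in Xw rw ew.
have restH : [set y | X y /\ y <> x] `<=` range phi.
  by move=> y [Xy yx]; exists y => //; exact: fix_phi.
apply: (@rank_bound _ (set F) _ (@translate1 F) (@translateM F) G X (range phi)
  (range phi `&` G) A B' A' x w bX Xw rw sH restH) => //.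
- by rewrite ew; exists x.
- by move=> g; rewrite translate_subgroup.
(* An element of [A'] is the image of a word in [X], and is spelled by replacing each letter by its
   image. *)
- move=> a /A'A/bA.1[[f _ <-] _].
  have [Xf _ <-] := reduced_wordP bX (I : [set: F] f).
  elim: (reduced_word X f) Xf => [|[y b] u IH].
    by exists [::]; rewrite // !word_val_nil phi1.
  move=> /word_on_cons[/= Xy /IH[u' gu' eu']]; rewrite word_val_cons gmulfM -eu'.
  suff [l gl <-] : exists2 l, word_on [set y | (X y /\ y <> x) \/
      y = word_val w /\ has (fun a => a.1 == x) w] l & word_val l = phi (letter_val (y, b)).
    by exists (l ++ u'); rewrite ?word_val_cat //; apply/word_on_cat.
  have ey c : phi (letter_val (y, c)) = letter_val (phi y, c).
    by case: c; rewrite /letter_val //= phiV.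
  have letter1 z : word_val [:: (z, b)] = letter_val (z, b) :> F.
    by rewrite word_val_cons word_val_nil mulg1.
  have [yx|yx] := pselect (y = x); last first.
    exists [:: (y, b)]; last by rewrite letter1 ey fix_phi.
    by apply/word_on_cons; split=> //; left.
  have [hx|nx] := boolP (has (fun a => a.1 == x) w).
    exists [:: (word_val w, b)]; last by rewrite letter1 ey ew yx.
    by apply/word_on_cons; split=> //; right.
  (* When [x] does not occur in [w], the word [w] itself spells the image of [x] in fixed
     generators. *)
  have restw : word_on [set y | (X y /\ y <> x) \/ y = word_val w /\ false] w.
    move=> c cw; left; split; first exact: Xw.
    by move=> cx; case/hasP: nx; exists c => //; apply/eqP.
  exists (if b then w else word_inv w); first by case: (b); [|exact: word_on_inv].
  by rewrite ey yx -ew; case: (b); rewrite ?word_val_inv.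
- move=> g /(translate_subgroup _ sG) /(reduced_wordP bB)[Bg _ eg].
  by exists (reduced_word B g) => //; rewrite -eB.
- move=> b bB'; apply/translate_subgroup => //; apply: bB.1; by rewrite eB.
Qed.
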